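(* Suppose the measure space $(X,\mathscr{A},\mu)$ is discrete. Let $p\in(0,1]$ and let $C_{\phi_i,\omega_i}$ be densely defined weighted composition operators in $L^2(\mu)$ such that $\phi_i$ is injective a.e. $[\mu_{\omega_i}]$, for $i=1,2$. Then the following assertions are equivalent: (i) $\mathbf{C}_{\phi,\omega}=(C_{\phi_1,\omega_1},C_{\phi_2,\omega_2})$ is spherically $p$-hyponormal; (ii) for every $f\in L^2(\mu)$, $$\int_X\big(h_{\phi_1,\omega_1}\circ\phi_1\cdot\chi_{\{\omega_1\neq0\}}+h_{\phi_2,\omega_2}\circ\phi_2\cdot\chi_{\{\omega_2\neq0\}}\big)^p|f|^2\,d\mu\le\int_X(h_{\phi_1,\omega_1}+h_{\phi_2,\omega_2})^p|f|^2\,d\mu;$$ (iii) $h_{\phi_1,\omega_1}\circ\phi_1\cdot\chi_{\{\omega_1\neq0\}}+h_{\phi_2,\omega_2}\circ\phi_2\cdot\chi_{\{\omega_2\neq0\}}\le h_{\phi_1,\omega_1}+h_{\phi_2,\omega_2}$ a.e. $[\mu]$.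
   Context: A measure space $(X,\mathscr{A},\mu)$ is discrete if $\mathscr{A}=2^X$, the set $\mathsf{At}(\mu)=\{x\in X:\mu(\{x\})>0\}$ is countable, $\mu(X\setminus\mathsf{At}(\mu))=0$, and $\mu(\{x\})<\infty$ for all $x\in X$. For $\phi:X\to X$ and $\omega:X\to\mathbb{C}$, put $\mu_\omega(\Delta)=\int_\Delta|\omega|^2d\mu$. The weighted composition operator $C_{\phi,\omega}$ in the complex Hilbert space $L^2(\mu)$ has domain $\{f\in L^2(\mu):\omega\cdot(f\circ\phi)\in L^2(\mu)\}$ and acts by $C_{\phi,\omega}f=\omega\cdot(f\circ\phi)$; it is always assumed that $\mu_\omega\circ\phi^{-1}\ll\mu$ (so $C_{\phi,\omega}$ is well-defined). $h_{\phi,\omega}:X\to[0,\infty]$ is the ($\mu$-a.e. unique) function with $\mu_\omega(\phi^{-1}(\Delta))=\int_\Delta h_{\phi,\omega}\,d\mu$ for all $\Delta\subseteq X$. $\phi$ is injective a.e. $[\mu_\omega]$ if $\mu_\omega(\{y\in X:\phi(y)=\phi(z),\,y\neq z\})=0$ for every $z\in\mathsf{At}(\mu_\omega)=\{x:\mu_\omega(\{x\})>0\}$. For densely defined $C_{\phi_1,\omega_1},C_{\phi_2,\omega_2}$ put $A=C_{\phi_1,\omega_1}^*C_{\phi_1,\omega_1}+C_{\phi_2,\omega_2}^*C_{\phi_2,\omega_2}$ (always positive self-adjoint) and $B=C_{\phi_1,\omega_1}C_{\phi_1,\omega_1}^*+C_{\phi_2,\omega_2}C_{\phi_2,\omega_2}^*$,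 with natural domains. For $0<p\le1$, the pair $(C_{\phi_1,\omega_1},C_{\phi_2,\omega_2})$ is spherically $p$-hyponormal if $B$ is self-adjoint, $\mathcal{D}(A^{p/2})\subseteq\mathcal{D}(B^{p/2})$, and $\|B^{p/2}f\|\le\|A^{p/2}f\|$ for all $f\in\mathcal{D}(A^{p/2})$, where powers are defined by the spectral functional calculus. *)

(* Defs.v *)
From HB Require Import structures.
From mathcomp Require Import all_boot all_order all_algebra.
From mathcomp Require Import all_classical all_reals all_analysis.
From mathcomp Require Import measurable_realfun.
From mathcomp Require Import complex.
From mathcomp Require Import ring.

Set Implicit Arguments.
Unset Strict Implicit.
Unset Printing Implicit Defensive.

Import Order.TTheory GRing.Theory Num.Theory.
Import numFieldNormedType.Exports.

Local Open Scope classical_set_scope.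
Local Open Scope ring_scope.
Local Open Scope complex_scope.

Notation Re := complex.Re.
Notation Im := complex.Im.
Notation normc := ComplexField.Normc.normc.

(* Unbounded operators in an inner product space [H] are represented by their
   graphs, subsets of [H * H]; [ip] is linear in its first argument. *)
Section Operators.
Context {R : realType} {H : lmodType R[i]}.
Variable ip : H -> H -> R[i].
Implicit Types (S T A B : set (H * H)) (u v w : H).

Definition hnorm u : R := Num.sqrt (Re (ip u u)).

Definition dom T : set H := [set u | exists v, T (u, v)].

Definition op_comp S T : set (H * H) :=
  [set uv | exists w, T (uv.1, w) /\ S (w, uv.2)].

Definition op_add S T : set (H * H) :=
  [set uv | exists v1 v2, [/\ S (uv.1, v1), T (uv.1, v2) & uv.2 = v1 + v2]].

Definition densely_defined T : Prop :=
  forall u (e : R), 0 < e -> exists v, dom T v /\ hnorm (u - v) < e.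

Definition adjoint T : set (H * H) :=
  [set fg | forall u v, T (u, v) -> ip v fg.1 = ip u fg.2].

Definition self_adjoint T : Prop := densely_defined T /\ T = adjoint T.

(* Projection-valued Borel measures on the real line.  Idempotence of
   [sproj D] is [sprojI] with [D = D'].  [smeas u] is the scalar measure
   [D |-> <E(D)u, u>], whose existence is the countable additivity of [E]. *)
Record spectral_measure := SpectralMeasure {
  sproj : set (measurableTypeR R) -> H -> H ;
  smeas : H -> {measure set (measurableTypeR R) -> \bar R} ;
  sproj_linear : forall D, measurable D -> linear (sproj D) ;
  sproj_sym : forall D, measurable D ->
    forall u v, ip (sproj D u) v = ip u (sproj D v) ;
  sprojT : forall u, sproj setT u = u ;
  sprojI : forall D D', measurable D -> measurable D' ->
    forall u, sproj (D `&` D') u = sproj D (sproj D' u) ;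
  smeasE : forall D, measurable D ->
    forall u, smeas u D = (Re (ip (sproj D u) u))%:E
}.

Definition sint_dom (E : spectral_measure) (g : R -> R) : set H :=
  [set u | (\int[smeas E u]_t ((g t) ^+ 2)%:E < +oo)%E].

(* [int g d<E(.)u, w>], the complex measure being expanded by polarization;
   the four integrals are finite as soon as [u] and [w] are in
   [sint_dom E g]. *)
Definition sint_form (E : spectral_measure) (g : R -> R) u w : R[i] :=
  4%:R^-1 * \sum_(k < 4)
    'i%C ^+ k * (\int[smeas E (u + 'i%C ^+ k *: w)]_t g t)%:C.

(* The operator [int g dE] for a real Borel function [g].  Since
   [sint_dom E g] is dense, testing against it determines [uv.2]. *)
Definition spectral_integral (E : spectral_measure) (g : R -> R) :
    set (H * H) :=
  [set uv | sint_dom E g uv.1 /\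
     forall w, sint_dom E g w -> ip uv.2 w = sint_form E g uv.1 w].

(* [A^a] for [A] positive self-adjoint and [a > 0]: [E] is the spectral
   measure of [A]; it vanishes on the negative half-line, so the values of
   [t `^ a] for [t < 0] are irrelevant. *)
Definition op_power A (a : R) : set (H * H) :=
  [set uv | exists E : spectral_measure,
     A = spectral_integral E (fun t => t) /\
     spectral_integral E (fun t => t `^ a) uv].

Definition spherically_hyponormal (p : R) T1 T2 : Prop :=
  let A := op_add (op_comp (adjoint T1) T1) (op_comp (adjoint T2) T2) in
  let B := op_add (op_comp T1 (adjoint T1)) (op_comp T2 (adjoint T2)) in
  [/\ self_adjoint B,
      dom (op_power A (p / 2)) `<=` dom (op_power B (p / 2)) &
      forall f a b, op_power A (p / 2) (f, a) -> op_power B (p / 2) (f, b) ->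
        hnorm b <= hnorm a].

End Operators.

Definition abs2 {R : realType} (z : R[i]) : R := (normc z) ^+ 2.

Section L2.
Context {d : measure_display} {X : measurableType d} {R : realType}.
Variable mu : {measure set X -> \bar R}.

Definition sq_integrable (f : X -> R[i]) : Prop :=
  [/\ measurable_fun setT (fun x => Re (f x)),
      measurable_fun setT (fun x => Im (f x)) &
      (\int[mu]_x (abs2 (f x))%:E < +oo)%E].

Definition sqint : {pred X -> R[i]} := [pred f | `[< sq_integrable f >]].

Let abs2E (z : R[i]) : abs2 z = (Re z) ^+ 2 + (Im z) ^+ 2.
Proof. by case: z => a b; rewrite /abs2 /= sqr_sqrtr // addr_ge0 ?sqr_ge0. Qed.

Let abs2_ge0 (z : R[i]) : 0 <= abs2 z.
Proof. exact: sqr_ge0. Qed.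

Let measurable_abs2 (f : X -> R[i]) :
  measurable_fun setT (fun x => Re (f x)) ->
  measurable_fun setT (fun x => Im (f x)) ->
  measurable_fun setT (EFin \o (fun x => abs2 (f x))).
Proof.
move=> mr mi; apply/measurable_EFinP.
under eq_fun do rewrite abs2E.
by apply: measurable_funD; apply: measurable_funX.
Qed.

Lemma sqint_submod_closed : submod_closed sqint.
Proof.
split.
  apply/asboolP; split; [exact: measurable_cst..|].
  under eq_integral do rewrite abs2E /= expr0n /= addr0.
  by rewrite integral0.
move=> a f g /asboolP[fr fi fi2] /asboolP[gr gi gi2].
have fgE x : (a *: f + g) x = a * f x + g x by [].
have mr : measurable_fun setT (fun x => Re ((a *: f + g) x)).
  have -> : (fun x => Re ((a *: f + g) x)) =
     (fun x => Re a * Re (f x) - Im a * Im (f x) + Re (g x)).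
    apply/funext => x; rewrite fgE.
    by case: (a) (f x) (g x) => [? ?] [? ?] [? ?].
  by apply: measurable_funD => //; apply: measurable_funB;
    apply: measurable_funM.
have mi : measurable_fun setT (fun x => Im ((a *: f + g) x)).
  have -> : (fun x => Im ((a *: f + g) x)) =
     (fun x => Re a * Im (f x) + Im a * Re (f x) + Im (g x)).
    apply/funext => x; rewrite fgE.
    by case: (a) (f x) (g x) => [? ?] [? ?] [? ?].
  by apply: measurable_funD => //; apply: measurable_funD;
    apply: measurable_funM.
apply/asboolP; split=> //.
pose K : R := 2 * abs2 a.
have K0 : 0 <= K by rewrite mulr_ge0 // abs2_ge0.
have bound x : abs2 ((a *: f + g) x)
    <= K * abs2 (f x) + 2 * abs2 (g x).
  rewrite fgE.
  rewrite /K /abs2 -mulrA -exprMn -ComplexField.Normc.normcM -!/(abs2 _).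
  set y := a * f x; set z := g x; rewrite !abs2E.
  case: y z => [y1 y2] [z1 z2] /=.
  rewrite -subr_ge0 [leRHS](_ : _ = (y1 - z1) ^+ 2 + (y2 - z2) ^+ 2); last ring.
  by rewrite addr_ge0 ?sqr_ge0.
have m2 c (k : X -> R[i]) : measurable_fun setT (fun x => Re (k x)) ->
    measurable_fun setT (fun x => Im (k x)) ->
    measurable_fun setT (fun x => (c%:E * (abs2 (k x))%:E)%E).
  by move=> kr ki; apply: measurable_funeM; exact: measurable_abs2.
apply: (@le_lt_trans _ _ (\int[mu]_x (K%:E * (abs2 (f x))%:E +
    2%:E * (abs2 (g x))%:E))%E).
  apply: ge0_le_integral => //.
  - by move=> x _; rewrite lee_fin abs2_ge0.
  - exact: measurable_abs2.
  - by apply: emeasurable_funD; exact: m2.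
  - by move=> x _; rewrite -!EFinM -EFinD lee_fin; exact: bound.
rewrite ge0_integralD //=; try exact: m2; try by
  move=> x _; rewrite -EFinM lee_fin mulr_ge0 ?abs2_ge0.
rewrite !ge0_integralZl_EFin //; try (by move=> x _; rewrite lee_fin abs2_ge0);
  try exact: measurable_abs2.
by apply: lte_add_pinfty; apply: lte_mul_pinfty.
Qed.

HB.instance Definition _ :=
  GRing.isSubmodClosed.Build _ _ sqint sqint_submod_closed.

Record sqfun := SqFun { sqfun_fun :> X -> R[i]; _ : sqfun_fun \in sqint }.

HB.instance Definition _ := [isSub for sqfun_fun].
HB.instance Definition _ := [Choice of sqfun by <:].
HB.instance Definition _ := [SubChoice_isSubLmodule of sqfun by <:].

Definition ae_null : {pred sqfun} :=
  [pred f : sqfun | `[< {ae mu, forall x, f x = 0} >]].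

Lemma ae_null_submod_closed : submod_closed ae_null.
Proof.
split; first by apply/asboolP; exact: aeW.
move=> a f g /asboolP f0 /asboolP g0; apply/asboolP.
apply: filterS2 f0 g0 => x fx gx.
by rewrite -[LHS]/(a * f x + g x) fx gx mulr0 addr0.
Qed.

HB.instance Definition _ :=
  GRing.isSubmodClosed.Build _ _ ae_null ae_null_submod_closed.

Local Open Scope quotient_scope.

Definition L2 := Quotient.quot ae_null.

HB.instance Definition _ := GRing.Zmodule.on L2.
HB.instance Definition _ := EqQuotient.on L2.

Lemma L2_eqP (f g : sqfun) :
  reflect {ae mu, forall x, f x = g x} (\pi_L2 f == \pi_L2 g).
Proof.
rewrite -(Quotient.idealrBE _ f g) inE.
apply: (iffP (asboolP _)); apply: filterS => x /=.
  by move=> fg0; apply/eqP; rewrite -subr_eq0; apply/eqP.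
by move=> fg; rewrite -[LHS]/(f x - g x) fg subrr.
Qed.

Definition L2_scale (a : R[i]) (u : L2) : L2 := \pi_L2 (a *: repr u).

Lemma pi_scale (a : R[i]) (f : sqfun) :
  L2_scale a (\pi_L2 f) = \pi_L2 (a *: f).
Proof.
apply/eqP/L2_eqP; have /eqP/L2_eqP := reprK (\pi_L2 f).
by apply: filterS => x e; exact: (congr1 (fun z => a * z) e).
Qed.

Let pi_add (f g : sqfun) : \pi_L2 f + \pi_L2 g = \pi_L2 (f + g).
Proof. exact/esym/Quotient.pi_add. Qed.

Let L2_scaleA a b u : L2_scale a (L2_scale b u) = L2_scale (a * b) u.
Proof.
elim/quotW: u => f.
by rewrite (pi_scale b f) !(pi_scale _ (_ *: f)) (pi_scale _ f) scalerA.
Qed.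

Let L2_scale1 : left_id 1 L2_scale.
Proof. by elim/quotW => f; rewrite pi_scale scale1r. Qed.

Let L2_scaleDr : right_distributive L2_scale +%R.
Proof.
move=> a; elim/quotW=> f; elim/quotW=> g.
rewrite pi_add (pi_scale a f) (pi_scale a g) (pi_scale a (f + g)) pi_add.
by rewrite scalerDr.
Qed.

Let L2_scaleDl u : {morph L2_scale^~ u : a b / a + b}.
Proof.
elim/quotW: u => f a b.
rewrite (pi_scale a f) (pi_scale b f) (pi_scale (a + b) f) pi_add.
by rewrite scalerDl.
Qed.

HB.instance Definition _ := GRing.Zmodule_isLmodule.Build R[i] L2
  L2_scaleA L2_scale1 L2_scaleDr L2_scaleDl.

Definition L2_fun (u : L2) : X -> R[i] := sqfun_fun (repr u).
Coercion L2_fun : L2 >-> Funclass.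

Definition L2_dot (u v : L2) : R[i] :=
  (\int[mu]_x Re (u x * (v x)^*%C)) +i* (\int[mu]_x Im (u x * (v x)^*%C)).

End L2.

Arguments L2 {d X R} mu.
Arguments L2_dot {d X R} mu u v.

Section WeightedComposition.
Context {d : measure_display} {X : measurableType d} {R : realType}.
Implicit Types (phi : X -> X) (omega : X -> R[i]) (h : X -> \bar R).

Definition atoms (m : set X -> \bar R) : set X :=
  [set x | (0 < m [set x])%E].

Definition discrete_measure (mu : {measure set X -> \bar R}) : Prop :=
  [/\ forall D : set X, measurable D,
      countable (atoms mu),
      mu (~` atoms mu) = 0%E &
      forall x, (mu [set x] < +oo)%E].

Variable mu : {measure set X -> \bar R}.

Definition weighted_measure omega (D : set X) : \bar R :=
  (\int[mu]_(x in D) (abs2 (omega x))%:E)%E.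

Definition wco_well_defined phi omega : Prop :=
  (fun D => weighted_measure omega (phi @^-1` D)) `<< mu.

(* The graph of [f |-> omega * (f \o phi)]: as the right-hand component ranges
   over [L2 mu], the domain is the maximal one.  Under [wco_well_defined] the
   choice of representatives made by the coercion to functions is
   immaterial. *)
Definition wco phi omega : set (L2 mu * L2 mu) :=
  [set uv : L2 mu * L2 mu | {ae mu, forall x, uv.2 x = omega x * uv.1 (phi x)}].

Definition wco_density phi omega h : Prop :=
  [/\ forall x, (0 <= h x)%E,
      measurable_fun setT h &
      forall D, measurable D ->
        weighted_measure omega (phi @^-1` D) = (\int[mu]_(x in D) h x)%E].

Definition injective_ae phi omega : Prop :=
  forall z, atoms (weighted_measure omega) z ->
    weighted_measure omega [set y | phi y = phi z /\ y <> z] = 0%E.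

(* [0 * +oo = 0], so the value is [0] wherever [omega] vanishes. *)
Definition density_comp phi omega h (x : X) : \bar R :=
  (h (phi x) * (\1_[set y | omega y != 0] x)%:E)%E.

End WeightedComposition.

Arguments wco {d X R} mu phi omega.

(* Main.v *)
From HB Require Import structures.
Require Import Defs.
From mathcomp Require Import all_boot all_order all_algebra.
From mathcomp Require Import all_classical all_reals all_analysis.
From mathcomp Require Import measurable_realfun.
From mathcomp Require Import complex.
From mathcomp Require Import ring lra.

Import Order.TTheory GRing.Theory Num.Theory.
Import numFieldNormedType.Exports.

(** Why the theorem holds.  The measure lives on countably many atoms of finite
mass, so a class in L2 is the same thing as its values at the atoms, and each
operator of the statement is diagonal with respect to the indicators
[delta x] of the atoms.

Write [C] for the operator with symbols [phi], [omega] and [h] for its density.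
The change of variables

  int |omega|^2 (F o phi) dmu = int h F dmu

([integral_wco]) identifies [C^* C] with multiplication by [h]
([wco_adjoint_comp]).  Injectivity of [phi] on the atoms where [omega] does not
vanish makes [h] finite at every atom, and makes [C C^*] the multiplication by
[h o phi] on the set where [omega] is nonzero, by [0] elsewhere
([wco_comp_adjoint]).  Sums of multiplications by nonnegative functions are
multiplications ([mul_opD]), so [A] and [B] are the multiplications by
[H = h1 + h2] and by the corresponding sum [G]; in particular [B] is always
self-adjoint ([mul_op_self_adjoint]).

It remains to compute powers: the [a]-th power of multiplication by [k] is
multiplication by [k ^ a] ([op_power_mul_op]).  A power is formed with any
spectral measure representing the operator, so that measure has to be shown
unique.  Here this needs no spectral theorem, because [delta x] is an
eigenvector: if [u] is an eigenvector for [l], pairing [A u = l u] with [E(D) u]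
gives [int_D (t - l) d<E(t)u, u> = 0] for all Borel sets [D], so that
[<E(.)u, u>] is concentrated at [l] and [E(D) u] is [u] or [0]
([sproj_eigenvector]).  As [E(D)] is symmetric, its values at [x] are read off
by pairing with [delta x]: it is multiplication by the indicator of the
preimage of [D] under [k].

Finally, (i) and (ii) both compare the integrals of [G ^ p |f|^2] and
[H ^ p |f|^2], the first for [f] in the domain of [H ^ (p/2)] and the second for
every [f].  Taking [f = delta x] shows that each implies [G x <= H x] at every
atom, which is (iii), and conversely [t |-> t ^ p] is nondecreasing
([power_le_pointwise], [weighted_le_pointwise]). *)

Local Open Scope classical_set_scope.
Local Open Scope ring_scope.
Local Notation Re := complex.Re.
Local Notation Im := complex.Im.
Set Implicit Arguments.
Unset Strict Implicit.
Unset Printing Implicit Defensive.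

(** * Change of variables *)

Section ImageDensity.
Local Open Scope ereal_scope.
Context d d' (T : measurableType d) (X : measurableType d') (R : realType).
Variables (mu : {measure set X -> \bar R}) (h : X -> T) (f : X -> R).
Hypotheses (mh : measurable_fun setT h) (mf : measurable_fun setT f).
Hypothesis f0 : forall x, (0 <= f x)%R.

(** The image under [h] of the measure with density [f] with respect to [mu]. *)
Definition image_density (D : set T) : \bar R :=
  \int[mu]_(x in h @^-1` D) (f x)%:E.

Let image_density0 : image_density set0 = 0.
Proof. by rewrite /image_density preimage_set0 integral_set0. Qed.

Let image_density_ge0 D : 0 <= image_density D.
Proof. by apply: integral_ge0 => x _; rewrite lee_fin. Qed.

Let image_density_additive : semi_sigma_additive image_density.
Proof.
move=> F mF tF mUF; rewrite /image_density preimage_bigcup.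
rewrite ge0_integral_bigcup //.
- by apply: is_cvg_nneseries => n _ _; exact: image_density_ge0.
- by move=> n; rewrite -[_ @^-1` _]setTI; exact: mh.
- by apply/measurable_EFinP; exact: measurable_funTS.
- by move=> x _; rewrite lee_fin.
- apply/trivIsetP => i j _ _ ij; rewrite -preimage_setI.
  by move/trivIsetP : tF => /(_ _ _ I I ij) ->; rewrite preimage_set0.
Qed.

Definition image_density_measure : {measure set T -> \bar R} :=
  HB.pack image_density (isMeasure.Build _ T R image_density
    image_density0 image_density_ge0 image_density_additive).

End ImageDensity.

Section ChangeOfVariables.
Local Open Scope ereal_scope.
Context d d' (T : measurableType d) (X : measurableType d') (R : realType).
Variables (m : {measure set T -> \bar R}) (mu : {measure set X -> \bar R}).
Variables (h : X -> T) (f : X -> R).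
Hypotheses (mh : measurable_fun setT h) (mf : measurable_fun setT f).
Hypothesis f0 : forall x, (0 <= f x)%R.
Hypothesis mE : forall D, measurable D ->
  m D = \int[mu]_(x in h @^-1` D) (f x)%:E.

Import HBNNSimple.

Let mpre D : measurable D -> measurable (h @^-1` D).
Proof. by move=> mD; rewrite -[_ @^-1` _]setTI; exact: mh. Qed.

(** On a simple function both sides are the same finite sum, the hypothesis on
[m] giving the measure of each level set. *)
Let nnsfun_transfer (s : {nnsfun T >-> R}) :
  \int[m]_t (s t)%:E = \int[mu]_x ((s (h x))%:E * (f x)%:E).
Proof.
have ms y : measurable (s @^-1` [set y]) by exact: measurable_sfunP.
have mi y : measurable_fun setT
    (fun x => (\1_(h @^-1` (s @^-1` [set y])) x * f x)%:E).
  apply/measurable_EFinP; apply: measurable_funM => //.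
  exact: measurable_indic (mpre (ms y)).
transitivity (\sum_(y \in range s) \int[mu]_x
    (y%:E * (\1_(h @^-1` (s @^-1` [set y])) x * f x)%:E)).
  rewrite integralT_nnsfun sintegralE; apply: eq_fsbigr => y /set_mem[t _ <-].
  rewrite mE // integral_mkcond ge0_integralZl_EFin //; last first.
    by move=> x _; rewrite lee_fin mulr_ge0.
  congr (_ * _); apply: eq_integral => x _.
  by rewrite restrict_EFin patch_indic mulrC.
rewrite -ge0_integral_fsum //.
- apply: eq_integral => x _; rewrite -EFinM fimfunE.
  under eq_fsbigr do rewrite -EFinM mulrA.
  by rewrite fsumEFin // mulr_fsuml.
- by move=> y; exact: measurable_funeM.
- move=> y x _; rewrite !EFinM muleA mule_ge0 ?lee_fin //.
  exact: (nnfun_muleindic_ge0 s y (h x)).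
Qed.

Lemma ge0_integral_transfer (k : T -> \bar R) :
  measurable_fun setT k -> (forall t, 0 <= k t) ->
  \int[m]_t k t = \int[mu]_x (k (h x) * (f x)%:E).
Proof.
move=> mk k0.
pose s := nnsfun_approx measurableT mk.
have sk t : (EFin \o s n) t @[n --> \oo] --> k t.
  by apply: cvg_nnsfun_approx.
have -> : \int[m]_t k t = limn (fun n => \int[m]_t (s n t)%:E).
  rewrite -monotone_convergence //.
  - by apply: eq_integral => t _; apply/esym/cvg_lim => //; exact: sk.
  - by move=> n; exact/measurable_EFinP/measurable_funP.
  - by move=> n x _; rewrite lee_fin.
  - by move=> x _ a b ab; rewrite lee_fin; exact/lefP/nd_nnsfun_approx.
have -> : \int[mu]_x (k (h x) * (f x)%:E) =
    limn (fun n => \int[mu]_x ((s n (h x))%:E * (f x)%:E)).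
  rewrite -monotone_convergence //.
  - apply: eq_integral => x _; apply/esym/cvg_lim => //.
    by apply: cvgeZr => //; exact: sk.
  - move=> n; apply: emeasurable_funM; last exact/measurable_EFinP.
    apply/measurable_EFinP; exact: (measurableT_comp (measurable_funP (s n)) mh).
  - by move=> n x _; rewrite mule_ge0 ?lee_fin.
  - move=> x _ a b ab; rewrite lee_wpmul2r ?lee_fin //.
    exact/lefP/nd_nnsfun_approx.
by congr (limn _); apply/funext => n; exact: nnsfun_transfer.
Qed.

(** No integrability is assumed: as [f] is nonnegative, the positive and
negative parts of the two integrands correspond to each other. *)
Lemma integral_transfer (k : T -> R) : measurable_fun setT k ->
  \int[m]_t (k t)%:E = \int[mu]_x (k (h x) * f x)%:E.
Proof.
move=> mk; have mk' : measurable_fun setT (EFin \o k) by exact/measurable_EFinP.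
rewrite integralE [RHS]integralE; congr (_ - _).
  rewrite ge0_integral_transfer //; last exact: measurable_funepos.
  apply: eq_integral => x _; rewrite !funeposE /= -!EFin_max -EFinM.
  by rewrite maxr_pMl // mul0r.
rewrite ge0_integral_transfer //; last exact: measurable_funeneg.
apply: eq_integral => x _; rewrite !funenegE /= -!EFin_max -EFinM.
by rewrite maxr_pMl // mul0r mulNr.
Qed.

End ChangeOfVariables.

Lemma integral_density d (T : measurableType d) (R : realType)
    (m mu : {measure set T -> \bar R}) (f k : T -> R) :
  measurable_fun setT f -> (forall x, 0 <= f x) ->
  (forall D, measurable D -> m D = \int[mu]_(x in D) (f x)%:E)%E ->
  measurable_fun setT k ->
  (\int[m]_t (k t)%:E = \int[mu]_x (k x * f x)%:E)%E.
Proof.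
move=> mf f0 mE mk.
exact: (@integral_transfer _ _ T T R m mu idfun f (@measurable_id _ T setT)).
Qed.

(** * Spectral measures and eigenvectors *)

Section Eigenvectors.
Local Open Scope complex_scope.
Context {R : realType} {H : lmodType R[i]}.
Variable ip : H -> H -> R[i].

Lemma sint_formE (E : spectral_measure ip) (g : R -> R) u w :
  sint_form E g u w =
    ((\int[smeas E (u + w)]_t g t - \int[smeas E (u - w)]_t g t) / 4)
    +i* ((\int[smeas E (u + 'i *: w)]_t g t
          - \int[smeas E (u - 'i *: w)]_t g t) / 4).
Proof.
rewrite /sint_form !big_ord_recr big_ord0 /= add0r.
have -> : 'i ^+ 3 = - 'i :> R[i] by rewrite exprS sqr_i mulrN1.
rewrite sqr_i expr0 expr1 !scale1r !scaleN1r !scaleNr mul1r.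
set a := Rintegral _ _ _; set b := Rintegral _ _ _; set c := Rintegral _ _ _.
set e := Rintegral _ _ _.
have -> : 4%:R^-1 = (4^-1)%:C :> R[i].
  by rewrite fmorphV rmorph_nat.
by apply/eqP; rewrite eq_complex /=; apply/andP; split; apply/eqP; ring.
Qed.

Record inner_product : Prop := InnerProduct {
  ipDl : forall u v w, ip (u + v) w = ip u w + ip v w ;
  ipZl : forall (a : R[i]) u w, ip (a *: u) w = a * ip u w ;
  ip_conj : forall u v, ip v u = (ip u v)^*%C ;
  ip_definite : forall u, Re (ip u u) = 0 -> u = 0 }.

Hypothesis ipP : inner_product.
Variable E : spectral_measure ip.
Local Notation RT := (measurableTypeR R).

Lemma ipDr u v w : ip u (v + w) = ip u v + ip u w.
Proof. by rewrite (ip_conj ipP) (ipDl ipP) rmorphD /= -!(ip_conj ipP). Qed.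

Lemma ipZr (a : R[i]) u v : ip u (a *: v) = a^*%C * ip u v.
Proof. by rewrite (ip_conj ipP) (ipZl ipP) rmorphM /= -(ip_conj ipP). Qed.

Lemma ipNl u v : ip (- u) v = - ip u v.
Proof. by rewrite -scaleN1r (ipZl ipP) mulN1r. Qed.

Lemma ipNr u v : ip u (- v) = - ip u v.
Proof. by rewrite (ip_conj ipP) ipNl rmorphN /= -(ip_conj ipP). Qed.

Lemma Re_ipC u v : Re (ip v u) = Re (ip u v).
Proof. by rewrite (ip_conj ipP u v); case: (ip u v). Qed.

Lemma sprojD D u v : measurable D -> sproj E D (u + v) = sproj E D u + sproj E D v.
Proof.
by move=> mD; have := sproj_linear E mD 1 u v; rewrite !scale1r.
Qed.

Lemma sprojN D u : measurable D -> sproj E D (- u) = - sproj E D u.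
Proof.
move=> mD; have := sproj_linear E mD (-1) u 0; rewrite !addr0 !scaleN1r => ->.
have := sproj_linear E mD (-1) 0 0; rewrite scaler0 addr0 scaleN1r addNr => ->.
by rewrite addr0.
Qed.

Lemma ip_sproj S D u : measurable S -> measurable D ->
  ip (sproj E S (sproj E D u)) (sproj E D u) = ip (sproj E (S `&` D) u) u.
Proof.
move=> mS mD; rewrite -sproj_sym // -!sprojI //; last exact: measurableI.
by rewrite setIC setIA setIid setIC.
Qed.

Lemma fin_smeas u S : measurable S -> smeas E u S \is a fin_num.
Proof. by move=> mS; rewrite smeasE. Qed.

Lemma smeas_sproj u D S : measurable D -> measurable S ->
  smeas E (sproj E D u) S = smeas E u (S `&` D).
Proof.
by move=> mD mS; rewrite !smeasE ?ip_sproj //; exact: measurableI.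
Qed.

Lemma integrable_smeas_cst u (c : R) :
  (smeas E u).-integrable setT (EFin \o cst c).
Proof.
apply/integrableP; split; first by apply/measurable_EFinP; exact: measurable_cst.
by rewrite /= integral_cst // lte_mul_pinfty // ltey_eq fin_smeas.
Qed.

Lemma integrable_mul_indic (m : {measure set RT -> \bar R}) (g : R -> R) D :
  measurable_fun (setT : set RT) g -> measurable D ->
  m.-integrable setT (EFin \o g) ->
  m.-integrable setT (EFin \o (fun t => g t * \1_D t)).
Proof.
move=> mg mD ig; apply: le_integrable ig => //.
  by apply/measurable_EFinP; apply: measurable_funM.
move=> t _ /=; rewrite lee_fin normrM ler_piMr // indicE.
by case: (t \in D); rewrite ?normr0 ?normr1.
Qed.

(** The scalar spectral measures are finite, so square integrability implies
integrability. *)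
Lemma sint_dom_integrable (g : R -> R) u : measurable_fun setT g ->
  sint_dom E g u -> (smeas E u).-integrable setT (EFin \o g).
Proof.
move=> mg ug; have mg' : measurable_fun setT (EFin \o g) by exact/measurable_EFinP.
have mg2 : measurable_fun setT (fun t => ((g t) ^+ 2)%:E).
  by apply/measurable_EFinP; exact: measurable_funX.
apply/integrableP; split => //.
apply: (@le_lt_trans _ _ (\int[smeas E u]_t (1 + (g t ^+ 2)%:E))%E).
  apply: ge0_le_integral => //.
  - exact: measurableT_comp.
  - exact: emeasurable_funD.
  - move=> t _ /=; rewrite -EFinD lee_fin -real_normK ?num_real //.
    by have := sqr_ge0 (`|g t| - 1); have := normr_ge0 (g t); nra.
rewrite ge0_integralD //; last by move=> t _; rewrite lee_fin sqr_ge0.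
by rewrite integral_cst // mul1e lte_add_pinfty // ltey_eq fin_smeas.
Qed.

Lemma sint_dom_sproj (g : R -> R) u D : measurable D ->
  measurable_fun setT g -> sint_dom E g u -> sint_dom E g (sproj E D u).
Proof.
move=> mD mg; apply: le_lt_trans; apply: ge0_le_measure_integral => //.
- move=> S mS; rewrite [leLHS]smeas_sproj //.
  by apply: le_measure; rewrite ?inE //; exact: measurableI.
- by move=> t; rewrite lee_fin sqr_ge0.
- by apply/measurable_EFinP; exact: measurable_funX.
Qed.

Lemma Rintegral_smeas_indic u D : measurable D ->
  \int[smeas E u]_t \1_D t = Re (ip (sproj E D u) u).
Proof. by move=> mD; rewrite /Rintegral integral_indic // setIT smeasE. Qed.

(** With [u = u_D + u_C] split along [D] and its complement, [u + u_D] is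
[2 u_D + u_C] and [u - u_D] is [u_C]; the two parts are orthogonal for every
[E(S)], whence the weights 4 and 0 on [D]. *)
Lemma smeas_pm_sproj u D (b : bool) S : measurable D -> measurable S ->
  smeas E (if b then u + sproj E D u else u - sproj E D u) S =
    (\int[smeas E u]_(t in S)
       (\1_(~` D) t + (if b then 4 else 0) * \1_D t : R)%:E)%E.
Proof.
move=> mD mS; pose c : R := if b then 4 else 0; set m := smeas E u.
set w := sproj E D u.
have mC : measurable (~` D) by exact: measurableC.
have mSD : measurable (S `&` D) by exact: measurableI.
have m1 : measurable_fun setT (\1_D : R -> R) by exact: measurable_indic.
have m1C : measurable_fun setT (\1_(~` D) : R -> R) by exact: measurable_indic.
transitivity (m (S `\` D) + c%:E * m (S `&` D))%E; last first.
  rewrite [RHS](_ : _ = (\int[m]_(t in S)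
    ((\1_(~` D) t)%:E + c%:E * (\1_D t)%:E))%E) //.
  rewrite ge0_integralD //.
  - rewrite integral_indic // ge0_integralZl_EFin // ?integral_indic //.
    + by rewrite setDE [~` D `&` _]setIC [D `&` S]setIC.
    + by apply/measurable_EFinP; exact: measurable_funTS.
    + by rewrite /c; case: (b).
  - by apply/measurable_EFinP; exact: measurable_funTS.
  - by move=> t _; rewrite mule_ge0 // lee_fin /c; case: (b).
  - by apply: measurable_funeM; apply/measurable_EFinP; exact: measurable_funTS.
have mDI : (m S = m (S `\` D) + m (S `&` D))%E by exact: measureDI.
have mR : m S = (Re (ip (sproj E S u) u))%:E by rewrite /m smeasE.
have mww : m (S `&` D) = (Re (ip (sproj E S w) w))%:E.
  by rewrite -smeas_sproj // smeasE.
have mwu : m (S `&` D) = (Re (ip (sproj E S w) u))%:E.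
  by rewrite /m smeasE // sprojI.
have uw : Re (ip (sproj E S u) w) = Re (ip (sproj E S w) u).
  by rewrite sproj_sym // Re_ipC.
have -> : smeas E (if b then u + w else u - w) S =
    (Re (ip (sproj E S u) u) + Re (ip (sproj E S w) w)
     + (if b then 2 else -2) * Re (ip (sproj E S w) u))%:E.
  rewrite smeasE //; congr (_%:E); case: (b).
    by rewrite sprojD // (ipDl ipP) !ipDr !raddfD /= uw; ring.
  rewrite sprojD // sprojN // (ipDl ipP) !ipDr !ipNl !ipNr.
  by rewrite !(raddfD, raddfN) /= uw; ring.
move: mDI; move: mww; rewrite mwu => -[<-]; rewrite mR.
case: (m (S `\` D)) => [z| |] //= [->].
by congr (_%:E); rewrite /c; case: (b); ring.
Qed.

(** The real part of [<l u, E(D)u>], computed once directly and once by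
polarization of the spectral integral. *)
Lemma eigenvector_mean (u : H) (l : R) (D : set RT) :
  spectral_integral E idfun (u, l%:C *: u) -> measurable D ->
  \int[smeas E u]_t ((t - l) * \1_D t) = 0.
Proof.
move=> [/= ud uE] mD; set m := smeas E u; pose w := sproj E D u.
have mC : measurable (~` D) by exact: measurableC.
have mid : measurable_fun setT (idfun : R -> R) by exact: measurable_id.
have m1 : measurable_fun setT (\1_D : R -> R) by exact: measurable_indic.
have m1C : measurable_fun setT (\1_(~` D) : R -> R) by exact: measurable_indic.
pose f (b : bool) (t : R) : R := \1_(~` D) t + (if b then 4 else 0) * \1_D t.
have f0 b t : 0 <= f b t by rewrite /f addr_ge0 // mulr_ge0 //; case: b.
have mf b : measurable_fun setT (f b).
  by apply: measurable_funD => //; apply: measurable_funM.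
have iid : m.-integrable setT (EFin \o (idfun : R -> R)).
  exact: sint_dom_integrable.
have iid1 S : measurable S ->
    m.-integrable setT (EFin \o (fun t : R => t * \1_S t)).
  by move=> mS; exact: integrable_mul_indic.
have ione : m.-integrable setT (EFin \o (\1_D : R -> R)).
  have := integrable_mul_indic (@measurable_cst _ _ RT R setT 1) mD
    (integrable_smeas_cst u 1).
  by apply: eq_integrable => // t _; rewrite /= mul1r.
have := uE w (sint_dom_sproj mD mid ud).
rewrite sint_formE (ipZl ipP) => /(congr1 (@complex.Re R)).
have -> : Re (l%:C * ip u w) = l * Re (ip u w).
  by case: (ip u w) => x y /=; rewrite mul0r subr0.
have transfer b := @integral_density _ RT R _ m (f b) idfun (mf b) (f0 b)
  (fun S mS => smeas_pm_sproj u b mD mS) mid.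
rewrite /= /Rintegral (transfer true) (transfer false) -!/(Rintegral _ _ _) /f.
have -> : \int[m]_t (t * (\1_(~` D) t + 4 * \1_D t)) =
    \int[m]_t (t * \1_(~` D) t) + 4 * \int[m]_t (t * \1_D t).
  rewrite -RintegralZl //; last exact: iid1.
  rewrite -RintegralD //; last 2 first.
  - exact: iid1.
  - by have := integrableZl measurableT 4 (iid1 _ mD).
  by apply: eq_Rintegral => t _; ring.
have -> : \int[m]_t (t * (\1_(~` D) t + 0 * \1_D t)) =
    \int[m]_t (t * \1_(~` D) t).
  by apply: eq_Rintegral => t _; ring.
have -> : Re (ip u w) = \int[m]_t \1_D t.
  by rewrite Rintegral_smeas_indic // Re_ipC.
move=> mean.
rewrite [LHS](_ : _ = \int[m]_t (t * \1_D t) - l * \int[m]_t \1_D t); first lra.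
rewrite -RintegralZl // -RintegralB //.
- by apply: eq_Rintegral => t _; ring.
- exact: iid1.
- by have := integrableZl measurableT l ione.
Qed.

(** [D] splits into a part above and a part below [l]; on each of them [t - l]
has a strict sign and mean [0]. *)
Lemma smeas_eigenvector (u : H) (l : R) (D : set RT) :
  spectral_integral E idfun (u, l%:C *: u) -> measurable D -> l \notin D ->
  smeas E u D = 0%E.
Proof.
move=> uE mD lD.
have mid : measurable_fun setT (idfun : R -> R) by exact: measurable_id.
have iid : (smeas E u).-integrable setT (EFin \o (idfun : R -> R)).
  by apply: sint_dom_integrable => //; case: uE.
have mB : measurable_fun setT (fun t : R => t - l) by exact: measurable_funB.
have mhalf (e : R) : measurable ([set t | 0 < e * (t - l)] : set RT).
  rewrite (_ : [set _ | _] = (fun t => e * (t - l)) @^-1` `]0, +oo[); last first.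
    by apply/seteqP; split => t /=; rewrite in_itv /= andbT.
  rewrite -[_ @^-1` _]setTI.
  by apply: measurable_funM => //; exact: measurable_itv.
have half (e : R) : smeas E u [set t | 0 < e * (t - l)] = 0%E.
  set S := [set t | _].
  have mS1 : measurable_fun setT (\1_S : R -> R).
    by apply: measurable_indic; exact: mhalf.
  pose k t := e * ((t - l) * \1_S t).
  have k0 t : 0 <= k t.
    rewrite /k mulrA indicE; have [|_] := boolP (t \in S); last by rewrite mulr0.
    by rewrite inE mulr1 => /ltW.
  have mk : measurable_fun setT (EFin \o k).
    apply/measurable_EFinP; apply: measurable_funM => //.
    exact: measurable_funM.
  have i1 : (smeas E u).-integrable setT (EFin \o (fun t => (t - l) * \1_S t)).
    apply: integrable_mul_indic => //; first exact: mhalf.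
    have -> : EFin \o (fun t : R => t - l) = ((EFin \o idfun) \- cst l%:E)%E by [].
    by apply: integrableB => //; exact: integrable_smeas_cst.
  have ik : (smeas E u).-integrable setT (EFin \o k).
    exact: (integrableZl measurableT e i1).
  have k_ae0 : ae_eq (smeas E u) setT (EFin \o k) (cst 0%E).
    apply/(@ae_eq_integral_abs _ RT R (smeas E u) setT measurableT _ mk).
    transitivity (\int[smeas E u]_t (k t)%:E)%E.
      by apply: eq_integral => t _; rewrite gee0_abs // lee_fin.
    rewrite -[LHS]fineK ?integrable_fin_num //; congr (_%:E).
    rewrite [LHS](_ : _ = \int[smeas E u]_t k t) // RintegralZl //.
    by rewrite eigenvector_mean ?mulr0 //; exact: mhalf.
  case: k_ae0 => N [mN N0 kN].
  apply: subset_measure0 N0 => //; first exact: mhalf.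
  move=> t St; apply: kN => /= kt.
  have [] := kt I; rewrite /k indicE mem_set // mulr1 => eq0.
  by move: St; rewrite /S /= eq0 ltxx.
apply: (@subset_measure0 _ RT _ (smeas E u) D
  ([set t | 0 < 1 * (t - l)] `|` [set t | 0 < -1 * (t - l)])) => //.
- by apply: measurableU; exact: mhalf.
- move=> t Dt /=; rewrite mul1r mulN1r subr_gt0 opprB subr_gt0.
  apply/orP; rewrite orbC -neq_lt; apply: contraNneq lD => <-.
  by rewrite inE.
- by apply: null_set_setU => //; try exact: mhalf; exact: half.
Qed.

(** [<E(D)u, u>] is the squared norm of [E(D)u], so the preceding lemma applies
to [D] if [l] is outside [D], and to its complement otherwise. *)
Lemma sproj_eigenvector (u : H) (l : R) (D : set RT) :
  spectral_integral E idfun (u, l%:C *: u) -> measurable D ->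
  sproj E D u = if l \in D then u else 0.
Proof.
move=> uE mD; case: ifPn => lD; last first.
  apply: (ip_definite ipP).
  have := ip_sproj u mD mD; rewrite setIid -sprojI // setIid => ->.
  by have := smeas_eigenvector uE mD lD; rewrite smeasE // => -[].
have mC : measurable (~` D) by exact: measurableC.
have lC : l \notin ~` D by rewrite in_setC lD.
apply/eqP; rewrite eq_sym -subr_eq0; apply/eqP.
apply: (ip_definite ipP).
have := ip_sproj u measurableT mD; rewrite sprojT setTI => ww.
rewrite (ipDl ipP) !ipDr !ipNl !ipNr ww.
have := smeas_eigenvector uE mC lC.
have : smeas E u setT = (smeas E u (setT `\` D) + smeas E u (setT `&` D))%E.
  exact: measureDI.
rewrite setTD setTI => /[swap] ->; rewrite add0e !smeasE // sprojT => -[uu].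
by rewrite !(raddfD, raddfN) /= uu Re_ipC; ring.
Qed.

End Eigenvectors.

(** * L2 over a discrete measure *)

Section DiscreteL2.
Local Open Scope complex_scope.
Local Open Scope quotient_scope.
Context {d : measure_display} {X : measurableType d} {R : realType}.
Variable mu : {measure set X -> \bar R}.
Hypothesis mu_discrete : discrete_measure mu.

Local Notation At := (atoms mu).

Lemma measurable_of_discrete (D : set X) : measurable D.
Proof. by case: mu_discrete. Qed.
Local Hint Resolve measurable_of_discrete : core.

Lemma measurable_fun_of_discrete d' (T : measurableType d') (D : set X)
    (f : X -> T) :
  measurable_fun D f.
Proof. by []. Qed.
Local Hint Resolve measurable_fun_of_discrete : core.

Lemma ae_atomsP (P : X -> Prop) :
  {ae mu, forall x, P x} <-> (forall x, At x -> P x).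
Proof.
split=> [[N [mN N0 PN]] x xAt|Px].
  apply: contrapT => nPx; move: (xAt); rewrite /atoms /=; apply/negP.
  rewrite -leNgt -N0; apply: le_measure; rewrite ?inE //.
  by move=> _ ->; exact: PN.
case: mu_discrete => _ _ AtC _; exists (~` At); split => // x /= nPx.
by move=> /Px.
Qed.

Definition mass (x : X) : R := fine (mu [set x]).

Lemma massE x : (mass x)%:E = mu [set x].
Proof.
rewrite /mass fineK // ge0_fin_numE //; by case: mu_discrete.
Qed.

Lemma mass_gt0 x : At x -> 0 < mass x.
Proof. by rewrite /atoms /= -massE lte_fin. Qed.

Lemma mass_neq0 x : At x -> mass x != 0.
Proof. by move=> /mass_gt0 /lt0r_neq0. Qed.

Lemma massC_neq0 x : At x -> (mass x)%:C != 0.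
Proof. by move=> Atx; rewrite eq_complex /= eqxx andbT mass_neq0. Qed.

Lemma eq_integral_atoms (f g : X -> \bar R) : (forall x, At x -> f x = g x) ->
  (\int[mu]_x f x = \int[mu]_x g x)%E.
Proof.
move=> fg; apply: ae_eq_integral => //.
have /ae_atomsP : forall x, At x -> f x = g x by [].
by apply: filterS => x.
Qed.

Lemma eq_Rintegral_atoms (f g : X -> R) : (forall x, At x -> f x = g x) ->
  \int[mu]_x f x = \int[mu]_x g x.
Proof. by move=> fg; congr fine; apply: eq_integral_atoms => x /fg ->. Qed.

Lemma le_integral_atoms (f g : X -> \bar R) : (forall x, 0 <= f x)%E ->
  (forall x, 0 <= g x)%E -> (forall x, At x -> f x <= g x)%E ->
  (\int[mu]_x f x <= \int[mu]_x g x)%E.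
Proof.
move=> f0 g0 fg; apply: ae_ge0_le_integral => //.
have /ae_atomsP : forall x, At x -> (f x <= g x)%E by [].
by apply: filterS => x.
Qed.

Lemma integral_atom (f : X -> \bar R) x :
  (forall y, At y -> y <> x -> f y = 0%E) ->
  (\int[mu]_y f y = f x * (mass x)%:E)%E.
Proof.
move=> f0.
rewrite massE -(integral_cst mu (measurable_of_discrete [set x])).
rewrite [RHS]integral_mkcond.
apply: eq_integral_atoms => y Aty; rewrite patchE.
case: ifPn; first by rewrite inE => ->.
by rewrite notin_setE => /f0 ->.
Qed.

Lemma Rintegral_atom (f : X -> R) x :
  (forall y, At y -> y <> x -> f y = 0) -> \int[mu]_y f y = f x * mass x.
Proof.
by move=> f0; rewrite /Rintegral (@integral_atom _ x) => // y Aty yx; rewrite f0.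
Qed.

Lemma sq_integrableP (f : X -> R[i]) :
  sq_integrable mu f <-> (\int[mu]_x (abs2 (f x))%:E < +oo)%E.
Proof. by split => [[]//|fi]; split. Qed.

Lemma L2_pi (f : sqfun mu) x : At x -> (\pi_(L2 mu) f : L2 mu) x = f x.
Proof.
move: x; apply/ae_atomsP.
by apply/L2_eqP; rewrite reprK.
Qed.

Lemma L2_sq (u : L2 mu) : (\int[mu]_x (abs2 (u x))%:E < +oo)%E.
Proof.
apply/sq_integrableP; rewrite /L2_fun; case: (repr u) => f fP /=.
exact/asboolP.
Qed.

Lemma L2_ext (u v : L2 mu) : (forall x, At x -> u x = v x) -> u = v.
Proof.
move=> uv; rewrite -[u]reprK -[v]reprK; apply/eqP/L2_eqP.
exact/ae_atomsP.
Qed.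

Lemma L2D (u v : L2 mu) x : At x -> (u + v : L2 mu) x = u x + v x.
Proof.
move=> Atx; have -> : u + v = \pi_(L2 mu) (repr u + repr v).
  by rewrite -[u in LHS]reprK -[v in LHS]reprK; exact/esym/Quotient.pi_add.
by rewrite L2_pi.
Qed.

Lemma L2Z (a : R[i]) (u : L2 mu) x : At x -> (a *: u : L2 mu) x = a * u x.
Proof. by move=> Atx; rewrite [a *: u]/(L2_scale a u) L2_pi. Qed.

Lemma L2_0 x : At x -> (0 : L2 mu) x = 0.
Proof. by move=> Atx; rewrite -(scale0r 0) L2Z // mul0r. Qed.

Lemma L2N (u : L2 mu) x : At x -> (- u : L2 mu) x = - u x.
Proof. by move=> Atx; rewrite -scaleN1r L2Z // mulN1r. Qed.

(** Total, with junk value [0] off the square integrable functions: spectral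
projections and indicators can then be written by their formulas. *)
Definition L2_of (f : X -> R[i]) : L2 mu :=
  match pselect (f \in sqint mu) with
  | left fP => \pi_(L2 mu) (SqFun fP)
  | right _ => 0
  end.

Lemma L2_ofE f x : (\int[mu]_x (abs2 (f x))%:E < +oo)%E -> At x -> L2_of f x = f x.
Proof.
move=> /sq_integrableP fi Atx; rewrite /L2_of.
case: pselect => [fP|]; first by rewrite L2_pi.
by case; exact/asboolP.
Qed.

Lemma abs2E (z : R[i]) : abs2 z = (Re z) ^+ 2 + (Im z) ^+ 2.
Proof. by case: z => a b; rewrite /abs2 /= sqr_sqrtr // addr_ge0 ?sqr_ge0. Qed.

Lemma abs2_ge0 (z : R[i]) : 0 <= abs2 z.
Proof. exact: sqr_ge0. Qed.

Lemma abs2_gt0 (z : R[i]) : z != 0 -> 0 < abs2 z.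
Proof.
move=> z0; rewrite lt_def abs2_ge0 andbT /abs2 sqrf_eq0.
by apply: contra z0 => /eqP /ComplexField.Normc.eq0_normc ->.
Qed.

Lemma abs2M (a b : R[i]) : abs2 (a * b) = abs2 a * abs2 b.
Proof. by rewrite /abs2 ComplexField.Normc.normcM exprMn. Qed.

Lemma abs2_real (a : R) : abs2 a%:C = a ^+ 2.
Proof. by rewrite abs2E /= expr0n addr0. Qed.

Lemma integrable_abs2 (f : X -> R[i]) : (\int[mu]_x (abs2 (f x))%:E < +oo)%E ->
  mu.-integrable setT (EFin \o (fun x => abs2 (f x))).
Proof.
move=> fi; apply/integrableP; split => //.
rewrite (eq_integral (fun x => (abs2 (f x))%:E)) // => x _.
by rewrite gee0_abs // lee_fin abs2_ge0.
Qed.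

Lemma integrable_dot (u v : L2 mu) :
  mu.-integrable setT (EFin \o (fun x => Re (u x * (v x)^*%C))) /\
  mu.-integrable setT (EFin \o (fun x => Im (u x * (v x)^*%C))).
Proof.
have i2 : mu.-integrable setT
    (fun x => (abs2 (u x))%:E + (abs2 (v x))%:E)%E.
  by apply: integrableD => //; apply: integrable_abs2; exact: L2_sq.
by split; apply: le_integrable i2 => // x _;
  rewrite /= lee_fin [leRHS]ger0_norm ?addr_ge0 ?abs2_ge0 // !abs2E;
  case: (u x) (v x) => [a b] [c e] /=; rewrite ler_norml; apply/andP; split;
  have := (sqr_ge0 (a - c), sqr_ge0 (a + c), sqr_ge0 (b - e), sqr_ge0 (b + e),
    sqr_ge0 (a - e), sqr_ge0 (a + e), sqr_ge0 (b - c), sqr_ge0 (b + c));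
  rewrite !(sqrrD, sqrrB) => -[[[[[[[? ?] ?] ?] ?] ?] ?] ?]; nra.
Qed.

Lemma L2_dot_conj (u v : L2 mu) : L2_dot mu v u = (L2_dot mu u v)^*%C.
Proof.
rewrite /L2_dot /=; congr (_ +i* _).
  by apply: eq_Rintegral => x _; case: (u x) (v x) => [a b] [c e] /=; ring.
rewrite -mulN1r -RintegralZl //; last by case: (integrable_dot u v).
by apply: eq_Rintegral => x _; case: (u x) (v x) => [a b] [c e] /=; ring.
Qed.

Lemma L2_dotDl (u v w : L2 mu) :
  L2_dot mu (u + v) w = L2_dot mu u w + L2_dot mu v w.
Proof.
have [ur ui] := integrable_dot u w; have [vr vi] := integrable_dot v w.
rewrite /L2_dot /= /GRing.add /=; congr (_ +i* _); rewrite -RintegralD //;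
  apply: eq_Rintegral_atoms => x Atx; rewrite L2D //;
  by case: (u x) (v x) (w x) => [? ?] [? ?] [? ?] /=; ring.
Qed.

Lemma L2_dotZl (a : R[i]) (u w : L2 mu) :
  L2_dot mu (a *: u) w = a * L2_dot mu u w.
Proof.
have [ur ui] := integrable_dot u w.
have ar (c : R) := integrableZl measurableT c ur.
have ai (c : R) := integrableZl measurableT c ui.
case: a => a b; rewrite /L2_dot /= /GRing.mul /=; congr (_ +i* _).
  rewrite -!RintegralZl // -RintegralB //; last 2 first.
    - exact: ar.
    - exact: ai.
  apply: eq_Rintegral_atoms => x Atx; rewrite L2Z //.
  by case: (u x) (w x) => [? ?] [? ?] /=; ring.
rewrite -!RintegralZl // -RintegralD //; last 2 first.
  - exact: ai.
  - exact: ar.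
apply: eq_Rintegral_atoms => x Atx; rewrite L2Z //.
by case: (u x) (w x) => [? ?] [? ?] /=; ring.
Qed.

Lemma L2_norm2 (u : L2 mu) :
  ((Re (L2_dot mu u u))%:E = \int[mu]_x (abs2 (u x))%:E)%E.
Proof.
rewrite /L2_dot /= /Rintegral fineK; last first.
  by apply: integrable_fin_num => //; case: (integrable_dot u u).
apply: eq_integral => x _; congr (_%:E); rewrite abs2E.
by case: (u x) => a b /=; ring.
Qed.

Lemma atom_le_integral (f : X -> \bar R) x : (forall y, 0 <= f y)%E ->
  (f x * (mass x)%:E <= \int[mu]_y f y)%E.
Proof.
move=> f0; rewrite massE -(integral_cst mu (measurable_of_discrete [set x])).
rewrite (eq_integral f) => [|y /set_mem ->] //.
exact: ge0_subset_integral.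
Qed.

Lemma L2_dot_definite (u : L2 mu) : Re (L2_dot mu u u) = 0 -> u = 0.
Proof.
move=> u0; apply: L2_ext => x Atx; rewrite L2_0 //.
have : ((abs2 (u x))%:E * (mass x)%:E <= 0)%E.
  rewrite -[leRHS](_ : \int[mu]_y (abs2 (u y))%:E = 0)%E; last by rewrite -L2_norm2 u0.
  by apply: (@atom_le_integral (fun y => (abs2 (u y))%:E)) => y; rewrite lee_fin abs2_ge0.
rewrite -EFinM lee_fin pmulr_lle0 ?mass_gt0 // => ux0.
apply: ComplexField.Normc.eq0_normc; apply/eqP; rewrite -sqrf_eq0.
by rewrite eq_le ux0 sqr_ge0.
Qed.

Lemma L2_dot_inner_product : inner_product (L2_dot mu).
Proof.
split; [exact: L2_dotDl|exact: L2_dotZl|exact: L2_dot_conj|].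
exact: L2_dot_definite.
Qed.

Definition delta (x : X) : L2 mu := L2_of (fun y => (\1_[set x] y)%:C).

Lemma deltaE x y : At y -> delta x y = (\1_[set x] y)%:C.
Proof.
move=> Aty; apply: L2_ofE => //.
rewrite (eq_integral (fun y => (\1_[set x] y)%:E)); last first.
  move=> z _; rewrite abs2_real indicE; case: (_ \in _); first by rewrite expr1n.
  by rewrite expr0n.
rewrite integral_indic // setIT; by case: mu_discrete.
Qed.

Lemma L2_dot_delta (u : L2 mu) x : At x ->
  L2_dot mu u (delta x) = u x * (mass x)%:C.
Proof.
move=> Atx; rewrite /L2_dot !(@Rintegral_atom _ x); last 2 first.
- move=> y Aty yx; rewrite deltaE // indicE memNset //=.
  by case: (u y) => a b /=; ring.
- move=> y Aty yx; rewrite deltaE // indicE memNset //=.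
  by case: (u y) => a b /=; ring.
rewrite deltaE // indicE mem_set //; case: (u x) => a b /=.
by apply/eqP; rewrite eq_complex /=; apply/andP; split; apply/eqP; ring.
Qed.

End DiscreteL2.

(** * Multiplication operators *)

Section Multiplication.
Local Open Scope complex_scope.
Context {d : measure_display} {X : measurableType d} {R : realType}.
Variable mu : {measure set X -> \bar R}.
Hypothesis mu_discrete : discrete_measure mu.

Local Notation At := (atoms mu).
Local Notation RT := (measurableTypeR R).

Let dmeas (D : set X) : measurable D.
Proof. exact: (measurable_of_discrete mu_discrete). Qed.
Local Hint Resolve dmeas : core.

Let dmeas_fun d' (T : measurableType d') (D : set X) (f : X -> T) : measurable_fun D f.
Proof. by []. Qed.
Local Hint Resolve dmeas_fun : core.

(** The maximal multiplication operator: as [uv.2] ranges over L2, its domain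
consists of the [u] with [k u] in L2. *)
Definition mul_op (k : X -> R) : set (L2 mu * L2 mu) :=
  [set uv : L2 mu * L2 mu | forall x, At x -> uv.2 x = (k x)%:C * uv.1 x].

Lemma dom_mul_op k (u : L2 mu) :
  dom (mul_op k) u <-> (\int[mu]_x (k x ^+ 2 * abs2 (u x))%:E < +oo)%E.
Proof.
have kE x : k x ^+ 2 * abs2 (u x) = abs2 ((k x)%:C * u x).
  by rewrite abs2M abs2_real.
split=> [[v kuv]|fin].
  rewrite (eq_integral_atoms mu_discrete (g := fun x => (abs2 (L2_fun v x))%:E)).
    exact: L2_sq.
  by move=> x Atx; rewrite kE kuv.
exists (L2_of mu (fun x => (k x)%:C * u x)) => x Atx.
rewrite L2_ofE // (eq_integral (fun x => (k x ^+ 2 * abs2 (u x))%:E)) // => y _.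
by rewrite kE.
Qed.

Lemma mul_op_sym k (u u' w w' : L2 mu) : mul_op k (u, u') -> mul_op k (w, w') ->
  L2_dot mu u' w = L2_dot mu u w'.
Proof.
move=> uu' ww'; rewrite /L2_dot; congr (_ +i* _);
  apply: (eq_Rintegral_atoms mu_discrete) => x Atx;
  rewrite uu' // ww' //=; case: (u x) (w x) => [a b] [c e] /=; ring.
Qed.

Lemma mul_op_delta k x : mul_op k (delta mu x, (k x)%:C *: delta mu x).
Proof.
move=> y Aty /=; rewrite L2Z // deltaE // indicE.
have [|_] := boolP (y \in [set x]); first by rewrite inE => ->.
by rewrite !mulr0.
Qed.

Lemma mul_op_adjoint k : adjoint (L2_dot mu) (mul_op k) = mul_op k.
Proof.
apply/seteqP; split => -[f g] /=; last first.
  by move=> fg u v uv; exact: mul_op_sym uv fg.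
move=> fg x Atx /=; have := fg _ _ (mul_op_delta k x).
rewrite (L2_dotZl mu_discrete) L2_dot_conj // [RHS]L2_dot_conj // !L2_dot_delta //=.
rewrite -[in LHS](conjc_real (k x)) -rmorphM => /(can_inj (@conjcK R)).
rewrite mulrA => /mulIf -> //.
exact: massC_neq0.
Qed.

Lemma L2_dot_restrict (u v : L2 mu) (D : set X) :
  (forall x, At x -> v x = (\1_D x)%:C * u x) ->
  ((Re (L2_dot mu v u))%:E = \int[mu]_(x in D) (abs2 (u x))%:E)%E.
Proof.
move=> vE; rewrite /L2_dot /= /Rintegral fineK; last first.
  by apply: integrable_fin_num => //; case: (integrable_dot mu_discrete v u).
rewrite [RHS]integral_mkcond; apply: eq_integral_atoms => // x Atx.
rewrite vE // patchE indicE.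
case: (x \in D); last by case: (u x) => a b /=; congr (_%:E); ring.
by rewrite abs2E; case: (u x) => a b /=; congr (_%:E); ring.
Qed.

Variable h : X -> R.

(** A spectral measure acting by multiplication with the indicators of the
preimages under [h] represents, through [g], the multiplication by [g o h]. *)
Section SpectralMeasureOfMultiplication.
Variable E : spectral_measure (L2_dot mu).
Hypothesis EhE : forall (D : set RT) (u : L2 mu) x, measurable D -> At x ->
  (sproj E D u : L2 mu) x = (\1_D (h x))%:C * u x.

Lemma smeas_mul_op (u : L2 mu) (D : set RT) : measurable D ->
  (smeas E u D = \int[mu]_(x in h @^-1` D) (abs2 (u x))%:E)%E.
Proof.
move=> mD; rewrite smeasE //; apply: L2_dot_restrict => x Atx.
by rewrite EhE.
Qed.

Lemma integral_smeas_mul_op (u : L2 mu) (g : R -> R) : measurable_fun setT g ->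
  (\int[smeas E u]_t (g t)%:E = \int[mu]_x (g (h x) * abs2 (u x))%:E)%E.
Proof.
move=> mg.
apply: (@integral_transfer _ _ RT X R _ mu h (fun x => abs2 (u x))) => //.
- by move=> x; exact: abs2_ge0.
- exact: smeas_mul_op.
Qed.

Lemma sint_dom_mul_op (g : R -> R) u : measurable_fun setT g ->
  sint_dom E g u <-> dom (mul_op (g \o h)) u.
Proof.
move=> mg; rewrite dom_mul_op /sint_dom /=.
by rewrite (integral_smeas_mul_op _ (measurable_funX 2 mg)).
Qed.

(** Both polarization identities hold at the level of the symmetric form
[<g(h) u, w>], so no further integral has to be computed. *)
Lemma sint_form_mul_op (g : R -> R) u u' w : measurable_fun setT g ->
  mul_op (g \o h) (u, u') -> dom (mul_op (g \o h)) w ->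
  sint_form E g u w = L2_dot mu u' w.
Proof.
move=> mg uu' [w' ww'].
have ipP := L2_dot_inner_product mu_discrete.
have Q z z' : mul_op (g \o h) (z, z') ->
    \int[smeas E z]_t g t = Re (L2_dot mu z' z).
  move=> zz'; rewrite /Rintegral integral_smeas_mul_op //=.
  apply: (eq_Rintegral_atoms mu_discrete) => x Atx.
  by rewrite zz' //= abs2E; case: (z x) => a b /=; ring.
have lin (a : R[i]) : mul_op (g \o h) (u + a *: w, u' + a *: w').
  by move=> x Atx /=; rewrite !(L2D, L2Z) // uu' // ww' //=; ring.
have := lin 1; have := lin (-1); have := lin 'i; have := lin (- 'i).
rewrite !scale1r !scaleN1r !scaleNr => i3 i1 i2 i0.
rewrite sint_formE (Q _ _ i3) (Q _ _ i2) (Q _ _ i1) (Q _ _ i0).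
have wu : L2_dot mu w' u = (L2_dot mu u' w)^*%C.
  by rewrite L2_dot_conj // (mul_op_sym uu' ww').
rewrite !(L2_dotDl mu_discrete, ipDr ipP, ipNl ipP, ipNr ipP).
rewrite !(L2_dot_conj mu_discrete ('i *: w) _).
rewrite !(L2_dotZl mu_discrete) wu (L2_dot_conj mu_discrete w u').
have -> : L2_dot mu w u' = (L2_dot mu u' w)^*%C by rewrite L2_dot_conj.
case: (L2_dot mu u' w) (L2_dot mu u' u) (L2_dot mu w' w) => [a b] [c e] [m n].
by apply/eqP; rewrite eq_complex /=; apply/andP; split; apply/eqP; field.
Qed.

Lemma spectral_integral_mul_op (g : R -> R) : measurable_fun setT g ->
  spectral_integral E g = mul_op (g \o h).
Proof.
move=> mg; apply/seteqP; split => -[u v] /=.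
  move=> [/(sint_dom_mul_op _ mg)[u' uu'] uv] x Atx /=.
  have dd : dom (mul_op (g \o h)) (delta mu x) by eexists; exact: mul_op_delta.
  have := uv _ (iffRL (sint_dom_mul_op _ mg) dd).
  rewrite (sint_form_mul_op mg uu' dd) !L2_dot_delta // => /mulIf -> //.
    exact: uu'.
  exact: massC_neq0.
move=> uv; split; first by apply/sint_dom_mul_op => //; exists v.
by move=> w /(sint_dom_mul_op _ mg) wd; rewrite (sint_form_mul_op mg uv).
Qed.

End SpectralMeasureOfMultiplication.

Let pr (D : set RT) (u : L2 mu) : L2 mu :=
  L2_of mu (fun x => (\1_D (h x))%:C * u x).

Let prE (D : set RT) (u : L2 mu) x : At x -> pr D u x = (\1_D (h x))%:C * u x.
Proof.
move=> Atx; rewrite /pr L2_ofE //.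
apply: le_lt_trans (L2_sq mu_discrete u); apply: ge0_le_integral => //.
- by move=> y _; rewrite lee_fin abs2_ge0.
- move=> y _; rewrite lee_fin abs2M abs2_real ler_piMl ?abs2_ge0 //.
Qed.

Let sm (u : L2 mu) : {measure set RT -> \bar R} :=
  @image_density_measure _ _ RT X R mu h (fun x => abs2 (u x))
    (@dmeas_fun _ RT setT h) (@dmeas_fun _ _ setT (fun x => abs2 (u x)))
    (fun x => abs2_ge0 (u x)).

Lemma multiplication_spectral_measure : exists E : spectral_measure (L2_dot mu),
  forall (D : set RT) (u : L2 mu) x, measurable D -> At x ->
  (sproj E D u : L2 mu) x = (\1_D (h x))%:C * u x.
Proof.
unshelve eexists (@SpectralMeasure R _ (L2_dot mu) pr sm _ _ _ _ _).
- move=> D mD a u v; apply: L2_ext => // x Atx.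
  by rewrite prE // !(L2D, L2Z) // !prE //; ring.
- move=> D mD u v; apply: (@mul_op_sym (fun x => \1_D (h x))) => x Atx; exact: prE.
- by move=> u; apply: L2_ext => // x Atx; rewrite prE // indicT mul1r.
- move=> D D' mD mD' u; apply: L2_ext => // x Atx; rewrite !prE //.
  by rewrite indicI rmorphM mulrA.
- move=> D mD u; apply/esym/L2_dot_restrict => x Atx; exact: prE.
- by move=> D u x mD Atx /=; exact: prE.
Qed.

(** The cut-offs of [u] to the sets where [|h| <= n] lie in the domain and
tend to [u]; they are written as spectral projections so that the squared
distance to [u] is a scalar spectral measure, continuous from above. *)
Lemma mul_op_densely_defined : densely_defined (L2_dot mu) (mul_op h).
Proof.
move=> u e e0; have [E EhE] := multiplication_spectral_measure.
have ipP := L2_dot_inner_product mu_discrete.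
pose F (n : nat) : set RT := [set t : R | n%:R < `|t|].
have mF n : measurable (F n).
  rewrite (_ : F n = Num.norm @^-1` `]n%:R, +oo[); last first.
    by apply/seteqP; split => t /=; rewrite in_itv /= andbT.
  by rewrite -[_ @^-1` _]setTI; apply: normr_measurable => //; exact: measurable_itv.
have FE : \bigcap_n F n = set0.
  apply/seteqP; split => // t /(_ (Num.trunc `|t|).+1 I) /=.
  by rewrite /F /= ltNge ltW // truncnS_gt.
have cvgF : smeas E u (F n) @[n --> \oo] --> 0%E.
  rewrite -(measure0 (smeas E u)) -FE; apply: nonincreasing_cvg_mu => //.
  - by rewrite ltey_eq fin_smeas.
  - by rewrite FE.
  - apply/nonincreasing_seqP => n; apply/subsetPset => t /=.
    by apply: le_lt_trans; rewrite ler_nat.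
have [n /= Fn] : exists n, (smeas E u (F n) < (e ^+ 2)%:E)%E.
  have : \forall n \near \oo, (smeas E u (F n) < (e ^+ 2)%:E)%E.
    apply: (cvgF [set y | (y < (e ^+ 2)%:E)%E]); apply: open_nbhs_nbhs.
    split; first exact: open_ereal_lt_ereal.
    by rewrite /= lte_fin exprn_gt0.
  by move=> [n _ /(_ n (leqnn n))]; exists n.
have mC : measurable (~` F n) by exact: measurableC.
exists (sproj E (~` F n) u); split.
  apply/dom_mul_op.
  apply: (le_lt_trans (y := \int[mu]_x ((n%:R ^+ 2)%:E * (abs2 (L2_fun u x))%:E)))%E.
    apply: le_integral_atoms => //.
    - by move=> x; rewrite lee_fin mulr_ge0 ?sqr_ge0 ?abs2_ge0.
    - by move=> x; rewrite mule_ge0 // lee_fin ?sqr_ge0 ?abs2_ge0.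
    - move=> x Atx; rewrite EhE // abs2M abs2_real -EFinM lee_fin mulrA.
      rewrite ler_wpM2r ?abs2_ge0 // indicE.
      have [|_] := boolP (h x \in ~` F n); last by rewrite expr0n mulr0 sqr_ge0.
      rewrite inE /F /= => /negP; rewrite -leNgt => hn.
      rewrite expr1n mulr1 -[leLHS]real_normK ?num_real //.
      by apply: lerXn2r; rewrite ?nnegrE.
  rewrite ge0_integralZl_EFin //; last by move=> x _; rewrite lee_fin abs2_ge0.
  by apply: lte_mul_pinfty => //; exact: L2_sq.
have -> : u - sproj E (~` F n) u = sproj E (F n) u.
  apply: L2_ext => // x Atx; rewrite L2D // L2N // !EhE //.
  rewrite !indicE in_setC; case: (h x \in F n) => /=.
    by rewrite mul0r subr0 mul1r.
  by rewrite mul0r mul1r subrr.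
rewrite /hnorm -(ltr_pXn2r (n := 2)) // ?nnegrE ?sqrtr_ge0 ?ltW //.
have := ip_sproj E u (mF n) (mF n); rewrite setIid -sprojI // setIid => ->.
move: Fn; rewrite smeasE // lte_fin => Fn; rewrite sqr_sqrtr //.
by rewrite -lee_fin -(smeasE E (mF n)) measure_ge0.
Qed.

Lemma mul_op_self_adjoint : self_adjoint (L2_dot mu) (mul_op h).
Proof.
by split; [exact: mul_op_densely_defined|rewrite mul_op_adjoint].
Qed.

(** Any spectral measure representing the multiplication by [h] sends
[delta x] to itself or to [0] according as [h x] is in [D] or not, and is then
determined by symmetry; conversely such a measure exists. *)
Lemma op_power_mul_op (a : R) :
  op_power (L2_dot mu) (mul_op h) a = mul_op (fun x => h x `^ a).
Proof.
have mid : measurable_fun (setT : set RT) (fun t : R => t) by exact: measurable_id.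
have mpow : measurable_fun (setT : set RT) (fun t : R => t `^ a).
  exact: measurable_powR.
apply/seteqP; split => uv.
  move=> [E [hE]].
  rewrite (@spectral_integral_mul_op E _ _ mpow) // => D u x mD Atx.
  have ipP := L2_dot_inner_product mu_discrete.
  have Ed : sproj E D (delta mu x) = (\1_D (h x))%:C *: delta mu x.
    have := @sproj_eigenvector _ _ _ ipP E (delta mu x) (h x) D.
    rewrite -[X in spectral_integral _ X]/(fun t => t) -hE => -> //; last first.
      exact: mul_op_delta.
    by rewrite indicE; case: (_ \in _); rewrite ?scale1r ?scale0r.
  have := sproj_sym E mD u (delta mu x).
  rewrite Ed (ipZr ipP) conjc_real !L2_dot_delta // mulrA => /mulIf -> //.
  exact: massC_neq0.
have [E EhE] := multiplication_spectral_measure.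
move=> uvh; exists E; split; first by rewrite (spectral_integral_mul_op EhE).
by rewrite (spectral_integral_mul_op EhE).
Qed.

End Multiplication.
Arguments mul_op {d X R} mu k.

(** * Weighted composition operators *)

Section WeightedComposition.
Local Open Scope complex_scope.
Context {d : measure_display} {X : measurableType d} {R : realType}.
Variable mu : {measure set X -> \bar R}.
Hypothesis mu_discrete : discrete_measure mu.
Variables (phi : X -> X) (omega : X -> R[i]) (h : X -> \bar R).
Hypothesis wd : wco_well_defined mu phi omega.
Hypothesis hP : wco_density mu phi omega h.
Hypothesis inj : injective_ae mu phi omega.

Local Notation At := (atoms mu).
Local Notation C := (wco mu phi omega).
Local Notation mass := (@mass _ X R mu).

Let dmeas (D : set X) : measurable D.
Proof. exact: (measurable_of_discrete mu_discrete). Qed.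
Local Hint Resolve dmeas : core.

Let dmeas_fun d' (T : measurableType d') (D : set X) (f : X -> T) : measurable_fun D f.
Proof. by []. Qed.
Local Hint Resolve dmeas_fun : core.

Lemma weighted_measure_ge x (D : set X) : D x ->
  ((abs2 (omega x) * mass x)%:E <= weighted_measure mu omega D)%E.
Proof.
move=> Dx; rewrite /weighted_measure integral_mkcond.
have := @atom_le_integral _ _ _ mu mu_discrete ((fun x => (abs2 (omega x))%:E) \_ D) x.
rewrite {1}patchE mem_set // -EFinM; apply => y.
by rewrite patchE; case: ifP => // _; rewrite lee_fin abs2_ge0.
Qed.

Lemma weighted_measure_atom x (D : set X) : D x ->
  (forall y, At y -> D y -> y <> x -> omega y = 0) ->
  weighted_measure mu omega D = (abs2 (omega x) * mass x)%:E.
Proof.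
move=> Dx D0; rewrite /weighted_measure integral_mkcond.
rewrite (integral_atom mu_discrete (x := x)).
  by rewrite patchE mem_set.
move=> y Aty yx; rewrite patchE; case: ifPn => //.
rewrite inE => Dy; rewrite D0 //.
by rewrite abs2E /= expr0n addr0.
Qed.

Lemma weight_atom_gt0 x : At x -> omega x != 0 -> 0 < abs2 (omega x) * mass x.
Proof. by move=> Atx ox; rewrite mulr_gt0 ?abs2_gt0 // mass_gt0. Qed.

(** Were [phi x] not an atom, the null set reduced to [phi x] would have a
preimage of positive weighted measure, against absolute continuity. *)
Lemma wco_atom x : At x -> omega x != 0 -> At (phi x).
Proof.
move=> Atx ox; apply: contrapT => nAt.
have m0 : mu [set phi x] = 0%E.
  by apply/eqP; rewrite eq_le measure_ge0 andbT leNgt; exact/negP.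
have /null_content_dominatesP := wd.
move=> /(_ [set phi x] (dmeas _) m0) /= w0.
have := @weighted_measure_ge x (phi @^-1` [set phi x]) erefl.
by rewrite w0 lee_fin leNgt weight_atom_gt0.
Qed.

Lemma wco_inj x y : At x -> At y -> omega x != 0 -> omega y != 0 ->
  phi x = phi y -> x = y.
Proof.
move=> Atx Aty ox oy xy; apply: contrapT => nxy.
have wx : atoms (weighted_measure mu omega) y.
  rewrite /atoms /= (lt_le_trans _ (@weighted_measure_ge y [set y] erefl)) //.
  by rewrite lte_fin weight_atom_gt0.
have := @weighted_measure_ge x [set z | phi z = phi y /\ z <> y] (conj xy nxy).
by rewrite inj // lee_fin leNgt weight_atom_gt0.
Qed.

Let hr x := fine (h x).

Lemma density_mass y :
  (h y * (mass y)%:E = weighted_measure mu omega (phi @^-1` [set y]))%E.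
Proof.
case: hP => h0 _ ->//; rewrite massE // -(integral_cst mu (dmeas [set y])).
by apply: eq_integral => z /set_mem ->.
Qed.

(** The fibre over [y] carries at most one atom of the weighted measure, and
that atom has finite weight. *)
Lemma density_fin_num y : At y -> h y \is a fin_num.
Proof.
move=> Aty; have h0 : (0 <= h y)%E by case: hP.
suff wf : weighted_measure mu omega (phi @^-1` [set y]) \is a fin_num.
  move: wf; rewrite -density_mass; case: (h y) h0 => [r| |] // _.
  by rewrite gt0_mulye // lte_fin mass_gt0.
have [[x [[Atx ox] xy]]|nx] := pselect (exists x, (At x /\ omega x != 0) /\ phi x = y).
  rewrite (@weighted_measure_atom x) // => z Atz zy zx.
  apply/eqP/negPn/negP => oz; apply: zx; apply: wco_inj => //.
  by rewrite xy.
rewrite /weighted_measure integral_mkcond (eq_integral_atoms mu_discrete (g := cst 0%E)).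
  by rewrite integral0.
move=> z Atz; rewrite patchE; case: ifPn => //; rewrite inE => zy.
have [->|oz] := eqVneq (omega z) 0; first by rewrite abs2E /= expr0n addr0.
by case: nx; exists z.
Qed.

Lemma density_fineK y : At y -> (hr y)%:E = h y.
Proof. by move=> Aty; rewrite fineK // density_fin_num. Qed.

Lemma density_ge0 y : 0 <= hr y.
Proof. by rewrite fine_ge0 //; case: hP. Qed.

Lemma density_phi x : At x -> omega x != 0 ->
  hr (phi x) * mass (phi x) = abs2 (omega x) * mass x.
Proof.
move=> Atx ox; have Atp := wco_atom Atx ox.
apply: EFin_inj; rewrite EFinM density_fineK // density_mass.
apply: (@weighted_measure_atom x) => // z Atz zy zx.
by apply/eqP/negPn/negP => oz; apply: zx; exact: wco_inj.
Qed.

Lemma integral_wco (F : X -> R) :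
  (\int[mu]_x (abs2 (omega x) * F (phi x))%:E = \int[mu]_y (hr y * F y)%:E)%E.
Proof.
pose m := @image_density_measure _ _ X X R mu phi (fun x => abs2 (omega x))
  (@dmeas_fun _ X setT phi) (@dmeas_fun _ _ setT (fun x => abs2 (omega x)))
  (fun x => abs2_ge0 (omega x)).
transitivity (\int[m]_y (F y)%:E)%E.
  rewrite (@integral_transfer _ _ X X R m mu phi (fun x => abs2 (omega x))) //.
    by apply: eq_integral => x _; rewrite mulrC.
  by move=> x; exact: abs2_ge0.
rewrite (@integral_density _ X R m mu hr) //.
- by apply: eq_integral => x _; rewrite mulrC.
- exact: density_ge0.
- move=> D mD; case: hP => _ _ /(_ D mD).
  rewrite /weighted_measure => hE.
  transitivity (\int[mu]_(x in D) h x)%E; first by rewrite -hE.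
  rewrite integral_mkcond [RHS]integral_mkcond.
  apply: eq_integral_atoms => // x Atx; rewrite !patchE.
  by case: ifP => // _; rewrite density_fineK.
Qed.

Lemma Rintegral_wco (F : X -> R) :
  \int[mu]_x (abs2 (omega x) * F (phi x)) = \int[mu]_y (hr y * F y).
Proof. by congr fine; exact: integral_wco. Qed.

Lemma wcoP (u v : L2 mu) : C (u, v) <-> forall x, At x -> v x = omega x * u (phi x).
Proof. exact: ae_atomsP. Qed.

Lemma wco_dot (u v u' v' : L2 mu) : C (u, v) -> C (u', v') ->
  L2_dot mu v v' = (\int[mu]_y (hr y * Re (u y * (u' y)^*%C)))
    +i* (\int[mu]_y (hr y * Im (u y * (u' y)^*%C))).
Proof.
move=> /wcoP uv /wcoP uv'; rewrite /L2_dot; congr (_ +i* _).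
  rewrite -(Rintegral_wco (fun y => Re (u y * (u' y)^*%C))).
  apply: (eq_Rintegral_atoms mu_discrete) => x Atx; rewrite uv // uv' //.
  case: (omega x) (u _) (u' _) => [a b] [c e] [m n].
  by rewrite abs2E /=; ring.
rewrite -(Rintegral_wco (fun y => Im (u y * (u' y)^*%C))).
apply: (eq_Rintegral_atoms mu_discrete) => x Atx; rewrite uv // uv' //.
case: (omega x) (u _) (u' _) => [a b] [c e] [m n].
by rewrite abs2E /=; ring.
Qed.

Lemma wco_total (u : L2 mu) :
  (\int[mu]_y (hr y * abs2 (u y))%:E < +oo)%E -> exists v : L2 mu, C (u, v).
Proof.
move=> ui; exists (L2_of mu (fun x => omega x * u (phi x))); apply/wcoP => x Atx.
rewrite L2_ofE //; apply: le_lt_trans ui.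
rewrite -(integral_wco (fun y => abs2 (u y))) (eq_integral
  (fun x => (abs2 (omega x) * abs2 (u (phi x)))%:E)) // => y _.
by rewrite abs2M.
Qed.

Lemma wco_delta y : At y -> exists v : L2 mu, C (delta mu y, v).
Proof.
move=> Aty; apply: wco_total.
rewrite (integral_atom mu_discrete (x := y)) -?EFinM ?ltry // => z Atz zy.
by rewrite deltaE // indicE memNset // abs2_real expr0n mulr0.
Qed.

(** Pairing with the image of [delta y] gives the values of [C^* C u] at [y].
For the converse inclusion, [<h u, u>] is finite as soon as [h u] is in L2, so
[C u] is defined, and the change of variables gives the adjoint relation. *)
Lemma wco_adjoint_comp : op_comp (adjoint (L2_dot mu) C) C = mul_op mu hr.
Proof.
have ipP := L2_dot_inner_product mu_discrete.
apply/seteqP; split => -[u w] /=.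
  move=> [v [uv vw]] y Aty /=; have [v' Cv'] := wco_delta Aty.
  have := vw _ _ Cv'; rewrite /= (wco_dot Cv' uv).
  rewrite !(Rintegral_atom mu_discrete (x := y)); last 2 first.
  - move=> z Atz zy; rewrite deltaE // indicE memNset //.
    by case: (L2_fun u z) => a b /=; ring.
  - move=> z Atz zy; rewrite deltaE // indicE memNset //.
    by case: (L2_fun u z) => a b /=; ring.
  rewrite (ip_conj ipP) L2_dot_delta // deltaE // indicE mem_set // => eqw.
  apply: (mulIf (massC_neq0 mu_discrete Aty)).
  move/(congr1 (@conjc R)): eqw; rewrite conjcK => <-.
  case: (L2_fun u y) => a b; apply/eqP; rewrite eq_complex /=.
  by apply/andP; split; apply/eqP; ring.
move=> uw.
have [v Cv] : exists v : L2 mu, C (u, v).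
  apply: wco_total.
  have [iw _] := integrable_dot mu_discrete w u.
  rewrite (eq_integral_atoms mu_discrete
    (g := EFin \o (fun y => Re (L2_fun w y * (L2_fun u y)^*%C)))).
    by rewrite ltey_eq (integrable_fin_num measurableT iw).
  move=> x Atx /=; rewrite uw //= abs2E.
  by case: (L2_fun u x) => a b /=; congr (_%:E); ring.
exists v; split => // u' v' Cv' /=.
rewrite (wco_dot Cv' Cv) /L2_dot; congr (_ +i* _);
  apply: (eq_Rintegral_atoms mu_discrete) => x Atx; rewrite uw //=;
  by case: (L2_fun u x) (L2_fun u' x) => [a b] [c e] /=; ring.
Qed.

(** The real function to which [density_comp] reduces at the atoms. *)
Definition range_density (x : X) : R := hr (phi x) * (omega x != 0)%:R.

(** By injectivity the image of [delta (phi x)] is supported by the single atom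
[x], so pairing with it determines [C^* f] at [phi x].  For the converse
inclusion the candidate [k] for [C^* f] is written as a multiple [h q] of the
density, where [q (phi x) = f x / omega x]: in this form the change of variables
turns both its norm and its pairings into integrals in [x]. *)
Lemma wco_comp_adjoint : op_comp C (adjoint (L2_dot mu) C) = mul_op mu range_density.
Proof.
have ipP := L2_dot_inner_product mu_discrete.
apply/seteqP; split => -[f w] /=.
  move=> [k [fk /wcoP kw]] x Atx /=; rewrite kw // /range_density.
  have [->|ox] := eqVneq (omega x) 0; first by rewrite mulr0 !mul0r.
  have Atp := wco_atom Atx ox; rewrite mulr1.
  have [v' /[dup] Cv' /wcoP v'E] := wco_delta Atp.
  have := fk _ _ Cv'; rewrite /= (ip_conj ipP k) L2_dot_delta //.
  rewrite (_ : L2_dot mu v' f = omega x * (L2_fun f x)^*%C * (mass x)%:C); last first.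
    have v'0 z : At z -> z <> x -> v' z = 0.
      move=> Atz zx; rewrite v'E //.
      have [->|oz] := eqVneq (omega z) 0; first by rewrite mul0r.
      rewrite (deltaE mu_discrete _ (wco_atom Atz oz)) indicE memNset ?mulr0 // => xz.
      exact/zx/wco_inj.
    rewrite /L2_dot !(Rintegral_atom mu_discrete (x := x)); last 2 first.
    - by move=> z Atz zx; rewrite v'0 // mul0r.
    - by move=> z Atz zx; rewrite v'0 // mul0r.
    rewrite v'E // deltaE // indicE mem_set // /=.
    case: (omega x) (L2_fun f x) => [a b] [c e]; apply/eqP; rewrite eq_complex /=.
    by apply/andP; split; apply/eqP; ring.
  move=> /(congr1 (@conjc R)); rewrite conjcK => eqk.
  apply: (mulIf (massC_neq0 mu_discrete Atp)).
  rewrite -mulrA -eqk [RHS]mulrAC -[in RHS]rmorphM /= density_phi //.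
  case: (omega x) (L2_fun f x) => [a b] [c e]; apply/eqP; rewrite eq_complex abs2E /=.
  by apply/andP; split; apply/eqP; ring.
move=> fw.
(* a left inverse of [phi] on the atoms where [omega] is nonzero; at the
   atoms outside the image of those, [h] vanishes *)
pose psi y := xget y [set x | (At x /\ omega x != 0) /\ phi x = y].
have psiK x : At x -> omega x != 0 -> psi (phi x) = x.
  move=> Atx ox; rewrite /psi; case: xgetP => [z -> [[Atz oz] zx]|/(_ x) []//].
  exact: wco_inj.
pose q y := L2_fun f (psi y) / omega (psi y).
have qE x : At x -> omega x != 0 -> q (phi x) = L2_fun f x / omega x.
  by move=> Atx ox; rewrite /q psiK.
pose kf y := (hr y)%:C * q y.
have kfin : (\int[mu]_y (abs2 (kf y))%:E < +oo)%E.
  have -> : (\int[mu]_y (abs2 (kf y))%:E = \int[mu]_y (hr y * (hr y * abs2 (q y)))%:E)%E.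
    by apply: eq_integral => y _; rewrite /kf abs2M abs2_real; congr (_%:E); ring.
  rewrite -(integral_wco (fun y => hr y * abs2 (q y))).
  have [iw _] := integrable_dot mu_discrete w f.
  rewrite (eq_integral_atoms mu_discrete
    (g := EFin \o (fun x => Re (L2_fun w x * (L2_fun f x)^*%C)))).
    by rewrite ltey_eq (integrable_fin_num measurableT iw).
  move=> x Atx /=; rewrite fw //= /range_density; congr (_%:E).
  have [ox|ox] := eqVneq (omega x) 0.
    by rewrite ox abs2E /=; case: (L2_fun f x) => a b /=; ring.
  rewrite mulrCA -abs2M qE // [omega x * _]mulrC divfK // mulr1 abs2E.
  by case: (L2_fun f x) => a b /=; ring.
exists (L2_of mu kf); split; last first.
  apply/wcoP => x Atx; rewrite fw //= /range_density.
  have [ox|ox] := eqVneq (omega x) 0; first by rewrite mulr0 ox !mul0r.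
  rewrite L2_ofE //; last exact: wco_atom.
  by rewrite /kf qE // mulr1; field.
move=> u v Cuv /=; have /wcoP uv := Cuv.
pose G y := L2_fun u y * (q y)^*%C.
have -> : L2_dot mu u (L2_of mu kf) = (\int[mu]_y (hr y * Re (G y)))
    +i* (\int[mu]_y (hr y * Im (G y))).
  rewrite /L2_dot; congr (_ +i* _); apply: (eq_Rintegral_atoms mu_discrete) => y Aty;
  rewrite L2_ofE // /kf /G; case: (L2_fun u y) (q y) => [a b] [c e] /=; ring.
rewrite -(Rintegral_wco (fun y => Re (G y))) -(Rintegral_wco (fun y => Im (G y))).
have GE x : At x -> (abs2 (omega x))%:C * G (phi x) = L2_fun v x * (L2_fun f x)^*%C.
  move=> Atx; rewrite /G uv //.
  have [->|ox] := eqVneq (omega x) 0; first by rewrite abs2E /= expr0n addr0 !mul0r.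
  rewrite qE // [in (_ / _)^*%C]rmorphM /= conjc_inv.
  have -> : (abs2 (omega x))%:C = omega x * (omega x)^*%C.
    case: (omega x) => a b; apply/eqP; rewrite eq_complex abs2E /=.
    by apply/andP; split; apply/eqP; ring.
  by field; rewrite conjc_eq0.
rewrite /L2_dot; congr (_ +i* _); apply: (eq_Rintegral_atoms mu_discrete) => x Atx;
  rewrite -GE //; case: (G _) => a b /=; ring.
Qed.

End WeightedComposition.

(** * The three assertions as a pointwise inequality *)

Section MulOpSum.
Context {d : measure_display} {X : measurableType d} {R : realType}.
Variable mu : {measure set X -> \bar R}.
Hypothesis mu_discrete : discrete_measure mu.
Local Open Scope complex_scope.

(** Nonnegativity excludes cancellation: [(a + b) u] in L2 forces [a u] and
[b u] in L2, so the natural domain of the sum is the maximal one. *)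
Lemma mul_opD (a b : X -> R) : (forall x, 0 <= a x) -> (forall x, 0 <= b x) ->
  op_add (mul_op mu a) (mul_op mu b) = mul_op mu (fun x => a x + b x).
Proof.
move=> a0 b0; apply/seteqP; split => -[u v] /=.
  move=> [v1 [v2 [/= uv1 uv2 ->]]] x Atx /=.
  by rewrite (L2D mu_discrete) // uv1 // uv2 //= rmorphD /= mulrDl.
move=> uv.
have dom_le (c : X -> R) : (forall x, 0 <= c x <= a x + b x) -> dom (mul_op mu c) u.
  move=> cab; apply/(dom_mul_op mu_discrete).
  have : dom (mul_op mu (fun x => a x + b x)) u by exists v.
  move=> /(dom_mul_op mu_discrete); apply: le_lt_trans.
  apply: le_integral_atoms => //.
  - by move=> x; rewrite lee_fin mulr_ge0 ?sqr_ge0 ?abs2_ge0.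
  - by move=> x; rewrite lee_fin mulr_ge0 ?sqr_ge0 ?abs2_ge0.
  move=> x _; rewrite lee_fin ler_wpM2r ?abs2_ge0 //.
  have /andP[c0 cle] := cab x.
  by apply: lerXn2r; rewrite ?nnegrE ?addr_ge0.
have [v1 uv1] : dom (mul_op mu a) u.
  by apply: dom_le => x; rewrite a0 lerDl b0.
have [v2 uv2] : dom (mul_op mu b) u.
  by apply: dom_le => x; rewrite b0 lerDr a0.
exists v1, v2; split => //; apply: (L2_ext mu_discrete) => x Atx.
by rewrite (L2D mu_discrete) // uv1 // uv2 // uv //= rmorphD /= mulrDl.
Qed.

End MulOpSum.

Section PowerComparison.
Context {d : measure_display} {X : measurableType d} {R : realType}.
Variable mu : {measure set X -> \bar R}.
Hypothesis mu_discrete : discrete_measure mu.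
Variables (G H : X -> R) (p : R).
Hypotheses (G0 : forall x, 0 <= G x) (H0 : forall x, 0 <= H x) (p0 : 0 < p).
Local Open Scope complex_scope.
Local Notation At := (atoms mu).

Lemma powR_half (t : R) : (t `^ (p / 2)) ^+ 2 = t `^ p.
Proof. by rewrite -powR_mulrn ?powR_ge0 // -powRrM divfK. Qed.

Lemma power_le_pointwise :
  (dom (op_power (L2_dot mu) (mul_op mu H) (p / 2))
     `<=` dom (op_power (L2_dot mu) (mul_op mu G) (p / 2)) /\
   forall f a b, op_power (L2_dot mu) (mul_op mu H) (p / 2) (f, a) ->
     op_power (L2_dot mu) (mul_op mu G) (p / 2) (f, b) ->
     hnorm (L2_dot mu) b <= hnorm (L2_dot mu) a)
  <-> (forall x, At x -> G x <= H x).
Proof.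
have normE (k : X -> R) (f a : L2 mu) : mul_op mu k (f, a) ->
    ((Re (L2_dot mu a a))%:E = \int[mu]_x (k x ^+ 2 * abs2 (f x))%:E)%E.
  move=> fa; rewrite (L2_norm2 mu_discrete).
  apply: (eq_integral_atoms mu_discrete) => x Atx.
  by rewrite fa //= abs2M abs2_real.
rewrite !op_power_mul_op //; split.
  move=> [_ GH] x Atx.
  have := GH _ _ _ (mul_op_delta mu_discrete (fun x => H x `^ (p / 2)) x)
    (mul_op_delta mu_discrete (fun x => G x `^ (p / 2)) x).
  have nd (k : X -> R) : Re (L2_dot mu ((k x)%:C *: delta mu x) ((k x)%:C *: delta mu x))
      = k x ^+ 2 * mass mu x.
    apply: EFin_inj; rewrite (normE _ _ _ (mul_op_delta mu_discrete k x)).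
    rewrite (integral_atom mu_discrete (x := x)) => [|y Aty yx].
      by rewrite deltaE // indicE mem_set // abs2_real expr1n mulr1.
    by rewrite deltaE // indicE memNset // abs2_real expr0n mulr0.
  have m0 := mass_gt0 mu_discrete Atx.
  rewrite /hnorm (nd (fun x => G x `^ (p / 2))) (nd (fun x => H x `^ (p / 2))).
  rewrite !powR_half ler_psqrt ?nnegrE ?mulr_ge0 ?powR_ge0 ?(ltW m0) // ler_pM2r //.
  rewrite leNgt [_ <= _]leNgt; apply: contra => HG.
  by apply: gt0_ltr_powR; rewrite ?nnegrE.
move=> GH; have GHp x : At x -> G x `^ p <= H x `^ p.
  by move=> Atx; apply: ge0_ler_powR; rewrite ?nnegrE ?GH // ltW.
have le2 (f : L2 mu) : (\int[mu]_x ((G x `^ (p / 2)) ^+ 2 * abs2 (f x))%:E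
    <= \int[mu]_x ((H x `^ (p / 2)) ^+ 2 * abs2 (f x))%:E)%E.
  apply: le_integral_atoms => //.
  - by move=> x; rewrite lee_fin mulr_ge0 ?sqr_ge0 ?abs2_ge0.
  - by move=> x; rewrite lee_fin mulr_ge0 ?sqr_ge0 ?abs2_ge0.
  by move=> x Atx; rewrite lee_fin ler_wpM2r ?abs2_ge0 // !powR_half GHp.
split.
  move=> f /(dom_mul_op mu_discrete) fH; apply/(dom_mul_op mu_discrete).
  exact: le_lt_trans (le2 f) fH.
move=> f a b fa fb; rewrite /hnorm ler_wsqrtr //.
by rewrite -lee_fin (normE _ _ _ fa) (normE _ _ _ fb) le2.
Qed.

Lemma weighted_le_pointwise :
  (forall f : X -> R[i], sq_integrable mu f ->
    (\int[mu]_x ((G x `^ p) * abs2 (f x))%:E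
     <= \int[mu]_x ((H x `^ p) * abs2 (f x))%:E)%E)
  <-> (forall x, At x -> G x <= H x).
Proof.
split=> [GH x Atx|GH f fi].
  pose f y : R[i] := (\1_[set x] y)%:C.
  have fi : sq_integrable mu f.
    apply/(sq_integrableP mu_discrete).
    rewrite (integral_atom mu_discrete (x := x)) -?EFinM ?ltry // => y _ yx.
    by rewrite /f indicE memNset // abs2_real expr0n.
  have := GH f fi; rewrite !(integral_atom mu_discrete (x := x)); last 2 first.
  - by move=> y _ yx; rewrite /f indicE memNset // abs2_real expr0n mulr0.
  - by move=> y _ yx; rewrite /f indicE memNset // abs2_real expr0n mulr0.
  rewrite /f indicE mem_set // abs2_real expr1n !mulr1 -!EFinM lee_fin.
  rewrite ler_pM2r ?mass_gt0 // leNgt [_ <= _]leNgt; apply: contra => HG.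
  by apply: gt0_ltr_powR; rewrite ?nnegrE.
apply: le_integral_atoms => //.
- by move=> x; rewrite lee_fin mulr_ge0 ?powR_ge0 ?abs2_ge0.
- by move=> x; rewrite lee_fin mulr_ge0 ?powR_ge0 ?abs2_ge0.
move=> x Atx; rewrite lee_fin ler_wpM2r ?abs2_ge0 //.
by apply: ge0_ler_powR; rewrite ?nnegrE ?GH // ltW.
Qed.

End PowerComparison.
Unset Implicit Arguments.

Theorem theorem36 (R : realType) (d : measure_display) (X : measurableType d)
  (mu : {measure set X -> \bar R}) (p : R)
  (phi1 phi2 : X -> X) (omega1 omega2 : X -> R[i]) (h1 h2 : X -> \bar R)
  (mu_discrete : discrete_measure mu)
  (p_gt0 : 0 < p) (p_le1 : p <= 1)
  (wd1 : wco_well_defined mu phi1 omega1)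
  (wd2 : wco_well_defined mu phi2 omega2)
  (h1P : wco_density mu phi1 omega1 h1)
  (h2P : wco_density mu phi2 omega2 h2)
  (dd1 : densely_defined (L2_dot mu) (wco mu phi1 omega1))
  (dd2 : densely_defined (L2_dot mu) (wco mu phi2 omega2))
  (inj1 : injective_ae mu phi1 omega1)
  (inj2 : injective_ae mu phi2 omega2) :
  let i_ := spherically_hyponormal (L2_dot mu) p
    (wco mu phi1 omega1) (wco mu phi2 omega2) in
  let ii_ := forall f : X -> R[i], sq_integrable mu f ->
    (\int[mu]_x ((density_comp phi1 omega1 h1 x
                    + density_comp phi2 omega2 h2 x) `^ p * (abs2 (f x))%:E)
     <= \int[mu]_x ((h1 x + h2 x) `^ p * (abs2 (f x))%:E))%E in
  let iii_ := {ae mu, forall x,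
    (density_comp phi1 omega1 h1 x + density_comp phi2 omega2 h2 x
     <= h1 x + h2 x)%E} in
  (i_ <-> ii_) /\ (ii_ <-> iii_).
Proof.
move=> i_ ii_ iii_.
(* the symbols of the multiplication operators [A] and [B] *)
pose H x := fine (h1 x) + fine (h2 x).
pose G x := range_density phi1 omega1 h1 x + range_density phi2 omega2 h2 x.
have H0 x : 0 <= H x by rewrite addr_ge0 // (density_ge0 h1P, density_ge0 h2P).
have r0 phi omega h : wco_density mu phi omega h ->
    forall x, 0 <= range_density phi omega h x.
  by move=> hP x; rewrite mulr_ge0 ?(density_ge0 hP) ?ler0n.
have G0 x : 0 <= G x by rewrite addr_ge0 // (r0 _ _ _ h1P, r0 _ _ _ h2P).
have HE x : atoms mu x -> (h1 x + h2 x = (H x)%:E)%E.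
  move=> Atx; rewrite EFinD.
  by rewrite (density_fineK mu_discrete h1P inj1) // (density_fineK mu_discrete h2P inj2).
have dcE phi omega h x : wco_well_defined mu phi omega ->
    wco_density mu phi omega h -> injective_ae mu phi omega -> atoms mu x ->
    density_comp phi omega h x = (range_density phi omega h x)%:E.
  move=> wd hP inj Atx; rewrite /density_comp /range_density indicE.
  have [ox|ox] := eqVneq (omega x) 0.
    by rewrite memNset /= ?ox ?eqxx // mulr0 mule0.
  rewrite mem_set //= mulr1 mule1 (density_fineK mu_discrete hP inj) //.
  exact: (wco_atom mu_discrete wd Atx ox).
have GE x : atoms mu x -> (density_comp phi1 omega1 h1 x
    + density_comp phi2 omega2 h2 x = (G x)%:E)%E.
  by move=> Atx; rewrite EFinD !dcE.
have iE : i_ <-> (forall x, atoms mu x -> G x <= H x).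
  rewrite /i_ /spherically_hyponormal.
  rewrite (wco_adjoint_comp mu_discrete h1P inj1).
  rewrite (wco_adjoint_comp mu_discrete h2P inj2).
  rewrite (wco_comp_adjoint mu_discrete wd1 h1P inj1).
  rewrite (wco_comp_adjoint mu_discrete wd2 h2P inj2).
  rewrite (mul_opD mu_discrete (density_ge0 h1P) (density_ge0 h2P)).
  rewrite (mul_opD mu_discrete (r0 _ _ _ h1P) (r0 _ _ _ h2P)).
  rewrite -(power_le_pointwise mu_discrete G0 H0 p_gt0).
  split=> [[]//|[? ?]]; split => //.
  exact: mul_op_self_adjoint.
have iiE : ii_ <-> (forall x, atoms mu x -> G x <= H x).
  rewrite -(weighted_le_pointwise mu_discrete G0 H0 p_gt0) /ii_.
  have E (k : X -> \bar R) (K : X -> R) (f : X -> R[i]) :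
      (forall x, atoms mu x -> k x = (K x)%:E) ->
      (\int[mu]_x (k x `^ p * (abs2 (f x))%:E) = \int[mu]_x (K x `^ p * abs2 (f x))%:E)%E.
    by move=> kK; apply: (eq_integral_atoms mu_discrete) => x Atx; rewrite kK.
  by split => + f fi => /(_ f fi); rewrite (E _ _ f GE) (E _ _ f HE).
have iiiE : iii_ <-> (forall x, atoms mu x -> G x <= H x).
  rewrite /iii_ (ae_atomsP mu_discrete).
  by split => GH x Atx; have := GH x Atx; rewrite GE // HE // lee_fin.
by rewrite iE iiE iiiE.
Qed.
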